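(* Let $(p_n)$ be a sequence of integers with $1\le p_n\le n$. Suppose that $\pi_n$ has exponential decrease, i.e. there are constants $C>0$ and $D<1$, not depending on $n$, such that $$\pi_n(p)\le D\,\pi_n(p-1)\qquad\text{for all integers } p \text{ with } Cp_n<p\le n .$$ Suppose that $g_S$ is the product of $|S|$ copies of a fixed univariate probability density of the form $e^{h}$ with mean zero and finite second moment, where $h:\mathbb{R}\to\mathbb{R}$ satisfies, for some constant $L$, $|h(x)-h(y)|\le L(1+|x-y|)$ for all $x,y\in\mathbb{R}$. Then for any $q\in(0,2]$, any $r_n>0$ satisfying $$r_n^2\ge\{p_n\log(n/p_n)\}\vee\log\frac1{\pi_n(p_n)},$$ and all sufficiently large $M$, as $p_n,n\to\infty$ such that $p_n/n\to0$, $$\sup_{\theta_0\in\ell_0[p_n]}P_{n,\theta_0}\,\Pi_n\bigl(\theta: d_q(\theta,\theta_0)>M r_n^q\,p_n^{1-q/2}\mid X\bigr)\to0 .$$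
   Context: For $\theta\in\mathbb{R}^n$, $P_{n,\theta}$ denotes the $N_n(\theta,I)$ distribution of $X=(X_1,\dots,X_n)$, with Lebesgue density $p_{n,\theta}$, and $P_{n,\theta}T$ denotes the expectation of $T=T(X)$ under it. The support of $\theta$ is $S_\theta=\{i:\theta_i\ne0\}$; $\ell_0[p]=\{\theta\in\mathbb{R}^n:|S_\theta|\le p\}$; $d_q(\theta,\theta')=\sum_{i=1}^n|\theta_i-\theta_i'|^q$ (no $q$th root); $a\vee b=\max(a,b)$. Prior $\Pi_n$ on $\mathbb{R}^n$: (P1) a dimension $p$ is drawn from a probability measure $\pi_n$ on $\{0,1,\dots,n\}$ with $\pi_n(p)>0$ for every $p$; (P2) given $p$, a subset $S\subset\{1,\dots,n\}$ with $|S|=p$ is drawn uniformly from the $\binom np$ subsets of size $p$; (P3) given $(p,S)$, the vector $\theta_S=(\theta_i:i\in S)$ is drawn from a probability density $g_S$ on $\mathbb{R}^S$ (if $p\ge1$), and the coordinates $\theta_i$, $i\notin S$, are set equal to $0$. Posterior: $\Pi_n(B\mid X)=\int_B p_{n,\theta}(X)\,d\Pi_n(\theta)\big/\int p_{n,\theta}(X)\,d\Pi_n(\theta)$ for Borel $B\subset\mathbb{R}^n$. *)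

(* Defs.v *)
From HB Require Import structures.
From mathcomp Require Import all_boot all_order all_algebra.
From mathcomp Require Import all_classical all_reals all_analysis measurable_realfun.

Set Implicit Arguments.
Unset Strict Implicit.
Unset Printing Implicit Defensive.

Import Order.TTheory GRing.Theory Num.Theory.
Import numFieldNormedType.Exports.

Local Open Scope classical_set_scope.
Local Open Scope ring_scope.

(* R^n: tuples of reals carry the product of the Borel sigma-algebras. *)
Notation Rvec R n := (n.-tuple (measurableTypeR R)).

Section product_law.
Context (R : realType).

Definition cons_vec n (u : measurableTypeR R * Rvec R n) : Rvec R n.+1 :=
  [tuple of u.1 :: u.2].

Lemma measurable_cons_vec n : measurable_fun setT (@cons_vec n).
Proof. exact: measurable_cons. Qed.

HB.instance Definition _ n :=
  isMeasurableFun.Build _ _ _ _ (@cons_vec n) (@measurable_cons_vec n).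

(* The law of a vector with independent coordinates, the i-th one of law mu i. *)
Fixpoint product_law n :
    ('I_n -> probability (measurableTypeR R) R) -> probability (Rvec R n) R :=
  match n with
  | 0 => fun _ => \d_([tuple] : Rvec R 0)
  | m.+1 => fun mu =>
      distribution (mu ord0 \x product_law (fun i => mu (lift ord0 i)))%E
        (@cons_vec m)
  end.

Lemma product_law_box n (mu : 'I_n -> probability (measurableTypeR R) R)
    (A : 'I_n -> set (measurableTypeR R)) :
  (forall i, measurable (A i)) ->
  product_law mu [set x | forall i, A i (tnth x i)] = (\prod_i mu i (A i))%E.
Proof.
elim: n mu A => [|n IHn] mu A mA.
  rewrite big_ord0 /= diracE; apply/eqP; rewrite eqe; apply/eqP.
  by rewrite mem_set// => -[].
rewrite big_ord_recl /= /distribution /pushforward.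
pose B := [set x : Rvec R n | forall i, A (lift ord0 i) (tnth x i)].
have mB : measurable B.
  have -> : B = \big[setI/setT]_(i < n) ((@tnth n _ ^~ i) @^-1` A (lift ord0 i)).
    rewrite -bigcap_seq; apply/seteqP; split => x /= Bx i.
      by move=> _; exact: Bx.
    by apply: Bx; rewrite /= mem_index_enum.
  apply: bigsetI_measurable => i _.
  by rewrite -[X in measurable X]setTI; exact: measurable_tnth.
rewrite (_ : _ @^-1` _ = A ord0 `*` B).
  rewrite product_measure1E//; congr (_ * _)%E.
  exact: (IHn (fun i => mu (lift ord0 i)) (fun i => A (lift ord0 i))).
apply/seteqP; split => [[a x] /= H|[a x] /= [Aa Bx] i].
  split; first exact: (H ord0).
  by move=> i; have := H (lift ord0 i); rewrite tnthS.
have [j ->|->] := unliftP ord0 i; first by rewrite tnthS; exact: Bx.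
exact: Aa.
Qed.

End product_law.

Section density.
Context (R : realType).

Record density := Density {
  pdf :> R -> R ;
  measurable_pdf : measurable_fun [set: R] pdf ;
  pdf_ge0 : forall x, 0 <= pdf x ;
  integral_pdf : (\int[lebesgue_measure]_x (pdf x)%:E)%E = 1%E
}.

Definition density_law (g : density) (A : set (measurableTypeR R)) : \bar R :=
  (\int[lebesgue_measure]_(x in A) (g x)%:E)%E.

Variable g : density.

Let density_law0 : density_law g set0 = 0%E.
Proof. exact: integral_set0. Qed.

Let density_law_ge0 A : (0 <= density_law g A)%E.
Proof. by apply: integral_ge0 => x _; rewrite lee_fin pdf_ge0. Qed.

Let density_law_sigma_additive : semi_sigma_additive (density_law g).
Proof.
move=> /= A mA tA mUA; rewrite /density_law ge0_integral_bigcup//=.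
- apply: is_cvg_ereal_nneg_natsum_cond => n _ _.
  by apply: integral_ge0 => x _; rewrite lee_fin pdf_ge0.
- by apply/measurable_EFinP; apply: measurable_funTS; exact: measurable_pdf.
- by move=> x _; rewrite lee_fin pdf_ge0.
Qed.

HB.instance Definition _ := isMeasure.Build _ _ _
  (density_law g) density_law0 density_law_ge0 density_law_sigma_additive.

Let density_law_setT : density_law g [set: _] = 1%E.
Proof. exact: integral_pdf. Qed.

HB.instance Definition _ :=
  @Measure_isProbability.Build _ _ R (density_law g) density_law_setT.

End density.

Section prior.
Context (R : realType) (n : nat).

(* A probability on {0, ..., n} with positive weights; only the values at
   p <= n are meaningful. *)
Record dim_prior := DimPrior {
  dim_weight :> nat -> R ;
  dim_weight_gt0 : forall p, (p <= n)%N -> 0 < dim_weight p ;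
  dim_weight_sum : \sum_(p < n.+1) dim_weight p = 1
}.

(* G S is the law on R^n of the vector equal to theta_S on S and to 0 off S. *)
Definition prior (pi : dim_prior) (G : {set 'I_n} -> probability (Rvec R n) R)
    (B : set (Rvec R n)) : \bar R :=
  (\sum_(p < n.+1) (pi p)%:E *
     \sum_(S : {set 'I_n} | #|S| == p) ('C(n, p)%:R^-1)%:E * G S B)%E.

Variables (pi : dim_prior) (G : {set 'I_n} -> probability (Rvec R n) R).

Let pi_ge0 (p : 'I_n.+1) : (0 <= (pi p)%:E)%E.
Proof. by rewrite lee_fin ltW// dim_weight_gt0// -ltnS. Qed.

Let invC_ge0 p : (0 <= ('C(n, p)%:R^-1 : R)%:E)%E.
Proof. by rewrite lee_fin invr_ge0. Qed.

Let weighted_sum_sigma_additive (I : finType) (P : pred I) (w : I -> R)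
    (m : I -> set (Rvec R n) -> \bar R) :
  (forall i, P i -> 0 <= w i) -> (forall i B, 0 <= m i B)%E ->
  (forall i, semi_sigma_additive (m i)) ->
  semi_sigma_additive (fun B => \sum_(i | P i) (w i)%:E * m i B)%E.
Proof.
move=> w0 m0 ms F mF tF mUF.
rewrite (_ : (fun k => _) = fun k =>
    (\sum_(i | P i) (w i)%:E * \sum_(0 <= j < k) m i (F j))%E); last first.
  apply/funext => k; rewrite exchange_big /=; apply: eq_bigr => i _.
  by rewrite ge0_sume_distrr// => j _.
apply: cvg_nnesum => i Pi.
  by apply: nearW => k; rewrite mule_ge0 ?lee_fin ?w0// sume_ge0.
by apply: cvgeZl => //; exact: ms.
Qed.

Let prior0 : prior pi G set0 = 0%E.
Proof.
by rewrite /prior big1// => p _; rewrite big1 ?mule0// => S _; rewrite measure0 mule0.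
Qed.

Let prior_ge0 B : (0 <= prior pi G B)%E.
Proof.
by apply: sume_ge0 => p _; apply: mule_ge0 => //; apply: sume_ge0 => S _; exact: mule_ge0.
Qed.

Let prior_sigma_additive : semi_sigma_additive (prior pi G).
Proof.
rewrite /prior; apply: weighted_sum_sigma_additive => [p _|p B|p].
- by rewrite -lee_fin.
- by apply: sume_ge0 => S _; exact: mule_ge0.
- apply: weighted_sum_sigma_additive => [S _|S B|S].
  + by rewrite -lee_fin.
  + exact: measure_ge0.
  + exact: measure_semi_sigma_additive.
Qed.

HB.instance Definition _ := isMeasure.Build _ _ _
  (prior pi G) prior0 prior_ge0 prior_sigma_additive.

Let prior_setT : prior pi G [set: _] = 1%E.
Proof.
transitivity (\sum_(p < n.+1) pi p)%:E; last by rewrite dim_weight_sum.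
rewrite /prior -sumEFin; apply: eq_bigr => p _.
under eq_bigr do rewrite probability_setT mule1.
rewrite sumEFin sumr_const (_ : #|_| = 'C(n, p)); last first.
  have := card_draws 'I_n p; rewrite card_ord => <-.
  by rewrite cardsE; apply: eq_card.
by rewrite -[_ *+ 'C(n, p)]mulr_natl mulfV ?mule1// pnatr_eq0 -lt0n bin_gt0 -ltnS.
Qed.

HB.instance Definition _ :=
  @Measure_isProbability.Build _ _ R (prior pi G) prior_setT.

End prior.

Section model.
Context (R : realType) (n : nat).
Implicit Types theta x : Rvec R n.

Definition normal_law theta : probability (Rvec R n) R :=
  product_law (fun i => normal_prob (tnth theta i) 1).

Definition normal_density theta x : R :=
  \prod_(i < n) normal_pdf (tnth theta i) 1 (tnth x i).

Definition supp theta : {set 'I_n} := [set i | tnth theta i != 0].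

Definition ell0 (p : nat) : set (Rvec R n) := [set theta | (#|supp theta| <= p)%N].

Definition dq (q : R) theta theta' : R :=
  \sum_(i < n) `|tnth theta i - tnth theta' i| `^ q.

(* theta_S has the product density prod_(i in S) g on R^S, and theta_i = 0 off S. *)
Definition slab_law (g : density R) (S : {set 'I_n}) : probability (Rvec R n) R :=
  product_law (fun i =>
    if i \in S then (density_law g : probability _ _) else \d_(0 : measurableTypeR R)).

(* Both integrals are finite (the normal density is bounded) and the
   denominator is positive, so taking [fine] loses nothing. *)
Definition posterior (Pi : probability (Rvec R n) R) x (B : set (Rvec R n)) : R :=
  fine (\int[Pi]_(theta in B) (normal_density theta x)%:E)%E /
  fine (\int[Pi]_theta (normal_density theta x)%:E)%E.

End model.

(* Main.v *)
(* Write s = p_n, let S1 contain the support of theta0 with |S1| = s, and let w_k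
   be the prior weight of a model of size k. All marginal likelihoods factor
   over coordinates; with rho = (g * phi) / phi, the posterior mass of the models
   of size k is proportional to w_k e_k(rho(X_1), ..., rho(X_n)), e_k being the
   elementary symmetric polynomial.

   Large models. Splitting off the coordinates of S1, the mass of {|S| > T} is
   bounded by a sum of ratios w_k e_(k-a) / (w_(a+j) e_j) over the coordinates
   outside S1. Those are pure noise with E rho(X_i) = 1, and e_k / e_j (k >= j)
   is a concave Moebius function of each rho(X_i), by log-concavity of the
   sequence e. Jensen's inequality then bounds the expectation by a ratio of
   binomial coefficients, and the exponential decrease of pi_n, from a dimension
   j proportional to s, makes the sum geometrically small.

   Small models. Let tau = 4 log(n / s). By Markov's inequality
   sum_i (eps_i^2 - tau)_+ <= r^2 with high probability, so that
   ||eps_U||^2 <= A r^2 for all sets U of size O(s) simultaneously. On this event,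
   if u = theta - theta0 is supported in U and ||u||^2 > c r^2, then
   p_theta / p_theta0 <= exp((2 A - c / 8) r^2 - ||u||^2 / 4). The factor
   exp(-||u||^2 / 4) pays for the ratios g(theta_i) / g(theta0_i), which are at
   most exponential in |u_i|, while the evidence is at least
   w_s p_theta0(X) prod_(i in S1) (const g(theta0_i)) with
   1 / w_s <= exp(s + 2 r^2). It remains to take c large. On vectors with O(s)
   nonzero coordinates, large d_q forces large Euclidean distance. *)

Require Import Defs.
From HB Require Import structures.
From mathcomp Require Import all_boot all_order all_algebra.
From mathcomp Require Import all_classical all_reals all_analysis measurable_realfun.
From mathcomp Require Import ring lra zify.

Set Implicit Arguments.
Unset Strict Implicit.
Unset Printing Implicit Defensive.

Import Order.TTheory GRing.Theory Num.Theory.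
Import numFieldNormedType.Exports.

Local Open Scope classical_set_scope.
Local Open Scope ring_scope.

(** * Elementary symmetric polynomials and log-concavity *)

Section symmetric_polynomials.
Context (R : realType).
Implicit Types Q : {poly R}.

(** The generating polynomial: its coefficient of degree [k] is the [k]-th elementary symmetric
    polynomial of the [x i] with [P i]. *)
Definition esym_poly (I : finType) (P : pred I) (x : I -> R) : {poly R} :=
  \prod_(i | P i) (1 + x i *: 'X).

Lemma coef_mul_linear (t : R) Q i :
  ((1 + t *: 'X) * Q)`_i = Q`_i + t * (if i is k.+1 then Q`_k else 0).
Proof.
rewrite mulrDl mul1r coefD -scalerAl coefZ coefXM.
by case: i.
Qed.

Lemma coef_esym_poly (I : finType) (x : I -> R) k :
  (esym_poly xpredT x)`_k = \sum_(S : {set I} | #|S| == k) \prod_(i in S) x i.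
Proof.
rewrite /esym_poly; under eq_bigr do rewrite addrC.
rewrite bigA_distr coef_sum (bigID (fun S : {set I} => #|S| == k))/=.
rewrite [X in _ + X]big1 ?addr0; last first.
  move=> S Sk; rewrite -big_mkcond/= scaler_prod prodr_const coefZ coefXn.
  by rewrite eq_sym (negbTE Sk) mulr0.
apply: eq_bigr => S /eqP Sk.
by rewrite -big_mkcond/= scaler_prod prodr_const coefZ coefXn Sk eqxx mulr1.
Qed.

Lemma esym_polyID (I : finType) (P : pred I) (x : I -> R) :
  esym_poly xpredT x = esym_poly P x * esym_poly (predC P) x.
Proof. by rewrite /esym_poly (bigID P). Qed.

Lemma coef_esym_poly_ge0 (I : finType) (P : pred I) (x : I -> R) k :
  (forall i, 0 <= x i) -> 0 <= (esym_poly P x)`_k.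
Proof.
move=> x0; rewrite /esym_poly.
elim/big_rec: _ k => [k|i Q _ IH k]; first by rewrite coef1; case: eqP.
by rewrite coef_mul_linear; case: k => [|k]; rewrite ?mulr0 ?addr0 ?addr_ge0 ?mulr_ge0.
Qed.

Lemma size_esym_poly (I : finType) (P : pred I) (x : I -> R) :
  (size (esym_poly P x) <= #|P|.+1)%N.
Proof.
rewrite -sum1_card /esym_poly.
elim/big_rec2: _ => [|i n Q _ IH]; first by rewrite size_poly1.
apply: (leq_trans (size_polyMleq _ _)).
have H : (size (1 + x i *: 'X)%R <= 2)%N.
  rewrite (leq_trans (size_polyD _ _))// size_poly1.
  by rewrite geq_max/= (leq_trans (size_scale_leq _ _))// size_polyX.
by rewrite -subn1 leq_subLR (leq_trans (leq_add H IH)).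
Qed.

(** Asking for all [i <= l], and not only for [i = l], excludes internal zeros: [1, 0, 0, 1] passes
    the local test but fails it after multiplication by [1 + t X] with [t > 0]. *)
Definition log_concave Q := (forall i, 0 <= Q`_i) /\
  forall i l, (i <= l)%N -> Q`_i * Q`_l.+2 <= Q`_i.+1 * Q`_l.+1.

Lemma log_concave1 : log_concave 1.
Proof.
split=> [i|i l _]; rewrite !coef1; first by case: eqP.
by rewrite mulr0 mul0r.
Qed.

(** The difference of the two sides is a quadratic polynomial in [t] whose coefficients are
    nonnegative by log-concavity of [Q]. *)
Lemma log_concaveM (t : R) Q : 0 <= t ->
  log_concave Q -> log_concave ((1 + t *: 'X) * Q).
Proof.
move=> t0 [Q0 QQ]; split=> [[|i]|i l il]; rewrite !coef_mul_linear.
- by rewrite mulr0 addr0.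
- by rewrite addr_ge0// mulr_ge0.
case: i il => [|i] il.
  rewrite mulr0 addr0.
  have := QQ 0%N l isT; have := mulr_ge0 t0 (mulr_ge0 t0 (mulr_ge0 (Q0 0%N) (Q0 l))).
  have := mulr_ge0 t0 (mulr_ge0 (Q0 1%N) (Q0 l)).
  move: (Q`_0) (Q`_1) (Q`_l) (Q`_l.+1) (Q`_l.+2) => a b c d e H1 H2 H3.
  rewrite -subr_ge0 (_ : _ - _ = t * (b * c) + t * (t * (a * c)) + (b * d - a * e)); last by ring.
  by rewrite addr_ge0 ?subr_ge0// addr_ge0// ?subr_ge0.
case: l il => // l; rewrite ltnS => il.
have H1 := QQ _ _ (il : (i.+1 <= l.+1)%N).
have H2 : 0 <= t * t * (Q`_i.+1 * Q`_l.+1 - Q`_i * Q`_l.+2).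
  by rewrite !mulr_ge0// subr_ge0 QQ.
(* Two comparisons through the middle term [Q_(i+1) Q_(l+2)]; for [i = l] the second one is an
   equality. *)
have H3 : 0 <= t * (Q`_i.+2 * Q`_l.+1 - Q`_i * Q`_l.+3).
  rewrite mulr_ge0// subr_ge0.
  have := QQ i l.+1 (leq_trans il (leqnSn _)).
  move=> /le_trans; apply.
  move: il; rewrite leq_eqVlt => /predU1P[->|il]; first by rewrite mulrC.
  exact: QQ.
rewrite -subr_ge0 (_ : _ - _ = (Q`_i.+2 * Q`_l.+2 - Q`_i.+1 * Q`_l.+3)
  + t * (Q`_i.+2 * Q`_l.+1 - Q`_i * Q`_l.+3)
  + t * t * (Q`_i.+1 * Q`_l.+1 - Q`_i * Q`_l.+2)); last by ring.
by rewrite addr_ge0 ?subr_ge0// addr_ge0// ?subr_ge0.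
Qed.

Lemma log_concave_exp N Q : log_concave Q -> log_concave ((1 + 'X) ^+ N * Q).
Proof.
move=> lcQ; elim: N => [|N IH]; first by rewrite expr0 mul1r.
by have := log_concaveM ler01 IH; rewrite scale1r mulrA -exprS.
Qed.

(* The ratio is a concave Moebius function of [t], hence lies below its tangent
   at [t = 1]. *)
Lemma moebius_tangent (a b c d t : R) : a * d <= b * c -> 0 <= d -> 0 <= c ->
  0 < c + d -> 0 < t ->
  (a + b * t) / (c + d * t) <=
  (a + b) / (c + d) + (b * c - a * d) / (c + d) ^+ 2 * (t - 1).
Proof.
move=> abcd d0 c0 cd0 t0.
have cdt0 : 0 < c + d * t.
  have [dE|dn0] := eqVneq d 0; first by move: cd0; rewrite dE mul0r addr0.
  by rewrite ltr_wpDl// mulr_gt0// lt_neqAle eq_sym dn0.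
rewrite -subr_ge0.
have -> : (a + b) / (c + d) + (b * c - a * d) / (c + d) ^+ 2 * (t - 1)
   - (a + b * t) / (c + d * t) =
   ((b * c - a * d) * d * (t - 1) ^+ 2) / ((c + d) ^+ 2 * (c + d * t)).
  by field; rewrite !gt_eqF.
apply: divr_ge0; last by rewrite mulr_ge0 ?sqr_ge0// ltW.
by rewrite mulr_ge0 ?sqr_ge0// mulr_ge0// subr_ge0.
Qed.

End symmetric_polynomials.

(** * Integrals against densities and product laws *)

Section integration.
Local Open Scope ereal_scope.

(* No measurability is needed: both sides are suprema over simple functions. *)
Lemma ge0_le_integral_nomeas d (T : measurableType d) (R : realType)
    (mu : {measure set T -> \bar R}) (f g : T -> \bar R) :
  (forall x, 0 <= f x) -> (forall x, f x <= g x) ->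
  \int[mu]_x f x <= \int[mu]_x g x.
Proof.
move=> f0 fg; rewrite !ge0_integralTE//; last first.
  by move=> x; exact: le_trans (fg x).
by apply: le_ereal_sup => _ [h hf <-]; exists h => // x; exact: le_trans (fg x).
Qed.

Import HBNNSimple.

(** The identity holds by [nuE] for indicators, hence for simple functions, and passes to [f] by
    monotone convergence. *)
Lemma ge0_integral_density d (T : measurableType d) (R : realType)
    (mu nu : {measure set T -> \bar R}) (w : T -> R) (f : T -> \bar R) :
  measurable_fun setT w -> (forall x, (0 <= w x)%R) ->
  (forall A, measurable A -> nu A = \int[mu]_(x in A) (w x)%:E) ->
  measurable_fun setT f -> (forall x, 0 <= f x) ->
  \int[nu]_x f x = \int[mu]_x (f x * (w x)%:E).
Proof.
move=> mw w0 nuE mf f0.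
pose h := nnsfun_approx measurableT mf.
have mwE : measurable_fun setT (EFin \o w) by exact/measurable_EFinP.
have w0E x : 0 <= (w x)%:E by rewrite lee_fin.
have -> : \int[nu]_x f x = lim (\int[nu]_x (EFin \o h n) x @[n --> \oo]).
  have fE x : f x = lim ((EFin \o h n) x @[n --> \oo]).
    by apply/esym/cvg_lim => //; exact: cvg_nnsfun_approx.
  under eq_integral => x _ do rewrite fE.
  apply: monotone_convergence => //.
  - by move=> n; apply/measurable_EFinP.
  - by move=> n x _ /=; rewrite lee_fin.
  - by move=> x _ a b ab; rewrite lee_fin; exact/lefP/nd_nnsfun_approx.
have -> : \int[mu]_x (f x * (w x)%:E) =
    lim (\int[mu]_x ((EFin \o h n) x * (w x)%:E) @[n --> \oo]).
  have fE x : f x * (w x)%:E = lim (((EFin \o h n) x * (w x)%:E) @[n --> \oo]).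
    by apply/esym/cvg_lim => //; apply: cvgeZr => //; exact: cvg_nnsfun_approx.
  under eq_integral => x _ do rewrite fE.
  apply: monotone_convergence => //.
  - by move=> n; apply: emeasurable_funM => //; exact/measurable_EFinP.
  - by move=> n x _ /=; rewrite mule_ge0// lee_fin.
  - move=> x _ a b ab; rewrite lee_wpmul2r// lee_fin.
    exact/lefP/nd_nnsfun_approx.
congr (lim (_ @ \oo)); apply/funext => n.
transitivity (\int[nu]_x
   (\sum_(y \in range (h n)) (y * \1_(h n @^-1` [set y]) x)%:E)).
  by apply: eq_integral => t tE; rewrite /= fimfunE -fsumEFin.
have mi r : measurable_fun setT (fun x => (r * \1_(h n @^-1` [set r]) x)%:E).
  by apply/measurable_EFinP; exact: measurable_funM.
rewrite ge0_integral_fsum//; last by move=> y x _; exact: nnfun_muleindic_ge0.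
transitivity (\int[mu]_x (\sum_(y \in range (h n))
    (y * \1_(h n @^-1` [set y]) x)%:E * (w x)%:E)); last first.
  apply: eq_integral => x _.
  rewrite -ge0_mule_fsuml => [|y]; last exact: nnfun_muleindic_ge0.
  by rewrite fsumEFin // -(fimfunE _ x).
rewrite ge0_integral_fsum//; last 2 first.
  - by move=> y; exact: emeasurable_funM.
  - by move=> y x _; rewrite mule_ge0// nnfun_muleindic_ge0.
apply: eq_fsbigr => r /set_mem [x _ <-{r}].
have r0 : (0 <= h n x)%R by [].
under [RHS]eq_integral do rewrite EFinM -muleA.
rewrite [RHS]ge0_integralZl//; last 2 first.
  - by apply: emeasurable_funM => //; exact/measurable_EFinP.
  - by move=> z _; rewrite mule_ge0// lee_fin.
under [LHS]eq_integral do rewrite EFinM.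
rewrite ge0_integralZl//; last exact/measurable_EFinP.
rewrite integral_indic// setIT nuE//.
congr (_ * _); rewrite integral_mkcond; apply: eq_integral => z _.
by rewrite patchE indicE; case: ifPn => _; rewrite ?mul1e ?mul0e.
Qed.

Section product_law_integral.
Context (R : realType).

Lemma ge0_integral_product_lawS n
    (mu : 'I_n.+1 -> probability (measurableTypeR R) R) (F : Rvec R n.+1 -> \bar R) :
  measurable_fun setT F -> (forall x, 0 <= F x) ->
  \int[product_law mu]_x F x =
  \int[mu ord0]_a \int[product_law (fun i => mu (lift ord0 i))]_y F (cons_vec (a, y)).
Proof.
move=> mF F0.
rewrite /= /distribution ge0_integral_pushforward//= preimage_setT.
rewrite fubini_tonelli1//=.
by apply: measurableT_comp => //; exact: measurable_cons_vec.
Qed.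

Lemma measurable_prod_tnth n (f : 'I_n -> R -> R) :
  (forall i, measurable_fun setT (f i)) ->
  measurable_fun setT (fun x : Rvec R n => (\prod_i f i (tnth x i))%R).
Proof.
move=> mf; apply: (@measurable_prod _ _ _ _ _ _ (fun i x => f i (tnth x i))) => i _.
by apply: (@measurableT_comp _ _ _ _ _ _ (f i)) => //; exact: measurable_tnth.
Qed.

Lemma integral_product_law_prod n (mu : 'I_n -> probability (measurableTypeR R) R)
    (f : 'I_n -> R -> R) (c : 'I_n -> R) :
  (forall i, measurable_fun setT (f i)) -> (forall i x, (0 <= f i x)%R) ->
  (forall i, \int[mu i]_x (f i x)%:E = (c i)%:E) ->
  \int[product_law mu]_x (\prod_i f i (tnth x i))%:E = (\prod_i c i)%:E.
Proof.
elim: n mu f c => [|n IHn] mu f c mf f0 fc.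
  rewrite big_ord0 (eq_integral (cst 1)); last by move=> x _; rewrite big_ord0.
  by rewrite integral_cst//; rewrite [X in _ * X]probability_setT mule1.
rewrite ge0_integral_product_lawS; last 2 first.
- by apply/measurable_EFinP; exact: measurable_prod_tnth.
- by move=> x; rewrite lee_fin prodr_ge0.
transitivity (\int[mu ord0]_a ((f ord0 a)%:E * (\prod_i c (lift ord0 i))%:E)).
  apply: eq_integral => a _.
  transitivity (\int[product_law (fun i => mu (lift ord0 i))]_y
      ((f ord0 a)%:E * (\prod_i f (lift ord0 i) (tnth y i))%:E)).
    apply: eq_integral => y _; rewrite -EFinM big_ord_recl/=.
    by under eq_bigr do rewrite tnthS.
  rewrite ge0_integralZl//; last 3 first.
  - apply/measurable_EFinP; exact: (measurable_prod_tnth (fun i => mf (lift ord0 i))).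
  - by move=> y _; rewrite lee_fin prodr_ge0.
  - by rewrite lee_fin.
  by rewrite (IHn _ (fun i => f (lift ord0 i)) (fun i => c (lift ord0 i))).
rewrite ge0_integralZr//; last 3 first.
- by apply/measurable_EFinP; exact: mf.
- by move=> x _; rewrite lee_fin.
- rewrite lee_fin prodr_ge0// => i _.
  by rewrite -lee_fin -fc integral_ge0// => x _; rewrite lee_fin.
by rewrite big_ord_recl fc.
Qed.

Lemma integral_product_law_tnth n (mu : 'I_n -> probability (measurableTypeR R) R)
    (f : R -> R) (c : R) (i : 'I_n) :
  measurable_fun setT f -> (forall x, (0 <= f x)%R) ->
  \int[mu i]_x (f x)%:E = c%:E ->
  \int[product_law mu]_x (f (tnth x i))%:E = c%:E.
Proof.
move=> mf f0 fc.
transitivity (\int[product_law mu]_x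
    (\prod_j (if j == i then f else cst 1%R) (tnth x j))%:E).
  apply: eq_integral => x _; rewrite (bigD1 i)//= eqxx big1 ?mulr1// => j /negbTE.
  by move=> ->.
rewrite (integral_product_law_prod (f := fun j => if j == i then f else cst 1%R)
    (c := fun j => if j == i then c else 1%R)).
- by rewrite (bigD1 i)//= eqxx big1 ?mulr1// => j /negbTE ->.
- by move=> j; case: ifP.
- by move=> j x; case: ifP => //= _; exact: ler01.
- move=> j; case: eqP => [->//|_] /=.
  by rewrite integral_cst//; rewrite [X in _ * X]probability_setT mule1.
Qed.

End product_law_integral.

End integration.

(** * Expected ratios of elementary symmetric polynomials *)

Section esym_expectation.
Context (R : realType).

(** On nonnegative reals the inverse is the real power of exponent -1, also at 0, where both
    vanish. *)
Lemma measurable_ge0_funV d (T : measurableType d) (f : T -> R) :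
  measurable_fun setT f -> (forall x, 0 <= f x) ->
  measurable_fun setT (fun x => (f x)^-1).
Proof.
move=> mf f0; under eq_fun do rewrite -powR_inv1//.
exact: (measurableT_comp (measurable_powR _)).
Qed.

Lemma measurable_coef_esym_poly d (T : measurableType d) (I : finType) (P : pred I)
    (h : I -> T -> R) (Q : {poly R}) k :
  (forall i, measurable_fun setT (h i)) ->
  measurable_fun setT (fun t => (esym_poly P (h ^~ t) * Q)`_k).
Proof.
move=> mh; rewrite /esym_poly; elim: (index_enum I) k => [|i s IH] k.
  under eq_fun do rewrite big_nil.
  exact: measurable_cst.
have [Pi|Pi] := boolP (P i); last first.
  by under eq_fun do rewrite big_cons (negbTE Pi); exact: IH.
under eq_fun do rewrite big_cons Pi -mulrA coef_mul_linear.
by apply: measurable_funD => //; apply: measurable_funM => //; case: k.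
Qed.

Lemma esym_poly_cons_vec n (P : pred 'I_n.+1) (rho : R -> R) (a : R) (y : Rvec R n) :
  esym_poly P (fun i => rho (tnth (cons_vec (a, y)) i)) =
  (if P ord0 then 1 + rho a *: 'X else 1) *
  esym_poly (fun i => P (lift ord0 i)) (fun i => rho (tnth y i)).
Proof.
rewrite /esym_poly big_mkcond big_ord_recl/= [in RHS]big_mkcond/=.
by congr (_ * _); apply: eq_bigr => i _; rewrite tnthS.
Qed.

Lemma card_ordS n (P : pred 'I_n.+1) :
  #|P| = (P ord0 + #|[pred i | P (lift ord0 i)]|)%N.
Proof.
rewrite -!sum1_card big_mkcond big_ord_recl/= [in RHS]big_mkcond/=.
by congr (_ + _)%N.
Qed.

(* Integrating the coordinates out one at a time replaces each [rho (tnth x i)]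
   by its mean 1. *)
Lemma integral_esym_ratio n (mu : 'I_n -> probability (measurableTypeR R) R)
    (P : pred 'I_n) (rho : R -> R) (Q : {poly R}) (j k : nat) :
  measurable_fun setT rho -> (forall x, 0 < rho x) ->
  (forall i, P i -> (\int[mu i]_x (rho x)%:E = 1)%E) ->
  log_concave Q -> (j <= k)%N -> 0 < ((1 + 'X) ^+ #|P| * Q)`_j ->
  (\int[product_law mu]_x
    ((esym_poly P (fun i => rho (tnth x i)) * Q)`_k /
     (esym_poly P (fun i => rho (tnth x i)) * Q)`_j)%:E
   <= (((1 + 'X) ^+ #|P| * Q)`_k / ((1 + 'X) ^+ #|P| * Q)`_j)%:E)%E.
Proof.
move=> mrho rho0; elim: n mu P Q => [|n IHn] mu P Q rho1 lcQ jk Qj.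
  have -> : #|P| = 0%N by apply: eq_card0 => -[].
  rewrite (eq_integral (cst (Q`_k / Q`_j)%:E)); last first.
    by move=> x _; rewrite /esym_poly big_ord0 mul1r.
  rewrite integral_cst//; rewrite [X in (_ * X)%E]probability_setT mule1.
  by rewrite expr0 mul1r.
have coef0 (z : Rvec R n.+1) l : 0 <= (esym_poly P (fun i => rho (tnth z i)) * Q)`_l.
  rewrite /esym_poly; elim/big_rec: _ l => [|i S _ IH] l.
    by rewrite mul1r; exact: lcQ.1.
  rewrite -mulrA coef_mul_linear.
  by case: l => [|l]; rewrite ?mulr0 ?addr0 ?addr_ge0 ?mulr_ge0// ltW.
have F0 z : (0 <= ((esym_poly P (fun i => rho (tnth z i)) * Q)`_k /
     (esym_poly P (fun i => rho (tnth z i)) * Q)`_j)%:E)%E.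
  by rewrite lee_fin divr_ge0.
have mE l : measurable_fun setT
    (fun z : Rvec R n.+1 => (esym_poly P (fun i => rho (tnth z i)) * Q)`_l).
  apply: (@measurable_coef_esym_poly _ _ _ P (fun i (z : Rvec R n.+1) => rho (tnth z i))).
  by move=> i; apply: (measurableT_comp mrho); exact: measurable_tnth.
rewrite ge0_integral_product_lawS//; last first.
  by apply/measurable_EFinP; apply: measurable_funM => //; exact: measurable_ge0_funV.
pose P' := [pred i | P (lift ord0 i)].
move: Qj; rewrite card_ordS -/P'.
have [P0|P0] := boolP (P ord0); last first.
  rewrite add0n => Qj.
  apply: (@le_trans _ _ (\int[mu ord0]_a
    (((1 + 'X) ^+ #|P'| * Q)`_k / ((1 + 'X) ^+ #|P'| * Q)`_j)%:E)%E).
    apply: ge0_le_integral_nomeas => [a|a]; first exact: integral_ge0.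
    under eq_integral do rewrite esym_poly_cons_vec (negbTE P0) mul1r.
    by apply: IHn => // i; exact: rho1.
  rewrite integral_cst//; rewrite [X in (_ * X)%E]probability_setT mule1//.
rewrite add1n => Qj.
pose G := (1 + 'X) ^+ #|P'| * Q.
have lcG : log_concave G by exact: log_concave_exp.
pose sh l := if l is l'.+1 then G`_l' else 0.
have GE t l : ((1 + 'X) ^+ #|P'| * ((1 + t *: 'X) * Q))`_l = G`_l + sh l * t.
  by rewrite mulrCA coef_mul_linear -/G mulrC.
have GS l : ((1 + 'X) ^+ #|P'|.+1 * Q)`_l = G`_l + sh l.
  by rewrite exprS -mulrA -/G -(mul1r (sh l)) -coef_mul_linear scale1r.
rewrite !GS in Qj *.
have sh0 l : 0 <= sh l by case: l => //= l; exact: lcG.1.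
(* Log-concavity of [G], in the form that makes the ratio concave in the value of [rho] at the first
   coordinate. *)
have cross l m : (l <= m)%N -> G`_m * sh l <= sh m * G`_l.
  case: l m => [|l] [|m] //=; rewrite ?mulr0 ?mul0r//.
    by move=> _; rewrite mulr_ge0// lcG.1.
  rewrite ltnS leq_eqVlt => /predU1P[->|]; first by rewrite mulrC.
  by case: m => // m lm; rewrite mulrC [leRHS]mulrC; exact: lcG.2.
(* The tangent at [t = 1] is [al + s * t]. Both coefficients are nonnegative, so its integral splits
   without integrability conditions, and the mean 1 of [rho] returns the value at [t = 1]. *)
pose s := (sh k * G`_j - G`_k * sh j) / (G`_j + sh j) ^+ 2.
pose al := (G`_k * G`_j + G`_k * sh j *+ 2 + sh k * sh j) / (G`_j + sh j) ^+ 2.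
have s0 : 0 <= s by rewrite divr_ge0 ?sqr_ge0// subr_ge0 cross.
have al0 : 0 <= al.
  by rewrite divr_ge0 ?sqr_ge0// !addr_ge0 ?mulrn_wge0 ?mulr_ge0// lcG.1.
have alE : (G`_k + sh k) / (G`_j + sh j) = al + s.
  by rewrite /al /s; field; rewrite gt_eqF.
apply: (@le_trans _ _ (\int[mu ord0]_a (al%:E + s%:E * (rho a)%:E))%E).
  apply: ge0_le_integral_nomeas => [a|a]; first exact: integral_ge0.
  (* The factor of the fixed first coordinate moves into [Q]; this is why the induction carries an
     arbitrary log-concave [Q]. *)
  have cv y : esym_poly P (fun i => rho (tnth (cons_vec (a, y)) i)) * Q =
      esym_poly P' (fun i => rho (tnth y i)) * ((1 + rho a *: 'X) * Q).
    by rewrite esym_poly_cons_vec P0 -mulrA mulrCA.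
  under eq_integral do rewrite cv.
  have pos : 0 < G`_j + sh j * rho a.
    have [shj|shj] := eqVneq (sh j) 0; first by move: Qj; rewrite shj mul0r addr0.
    by rewrite ltr_wpDl ?lcG.1// mulr_gt0// lt_neqAle eq_sym shj sh0.
  apply: (le_trans (IHn _ _ _ _ _ _ _)) => //.
  - by move=> i; exact: rho1.
  - by apply: log_concaveM => //; exact: ltW.
  - by rewrite GE.
  rewrite !GE lee_fin; apply: (le_trans (moebius_tangent (cross _ _ jk) _ _ _ _)) => //.
    exact: lcG.1.
  by rewrite -/s alE (_ : al + s + _ = al + s * rho a)//; ring.
rewrite ge0_integralD//; last 2 first.
- by move=> a _; rewrite mule_ge0// lee_fin// ltW.
- by apply: emeasurable_funM => //; exact/measurable_EFinP.
rewrite ge0_integralZl//; last 2 first.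
- exact/measurable_EFinP.
- by move=> a _; rewrite lee_fin ltW.
rewrite rho1// mule1 integral_cst//; rewrite [X in (_ * X)%E]probability_setT mule1.
by rewrite -EFinD -alE.
Qed.

End esym_expectation.

(** * One coordinate: marginal density and Gaussian integrals of the slab *)

Section slab_density.
Context (R : realType) (g : density R) (h : R -> R) (L : R).
Hypothesis g_exp : forall x, g x = expR (h x).
Hypothesis h_lip : forall x y, `|h x - h y| <= L * (1 + `|x - y|).

Let G : probability (measurableTypeR R) R := density_law g.

Lemma lip_const_ge0 : 0 <= L.
Proof. by have := h_lip 0 0; rewrite !subrr normr0 addr0 mulr1. Qed.

Lemma slab_density_gt0 x : 0 < g x.
Proof. by rewrite g_exp expR_gt0. Qed.

Lemma slab_density_lip a t : g t <= g a * expR (L * (1 + `|t - a|)).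
Proof.
rewrite !g_exp -expRD ler_expR -lerBlDl.
by rewrite (le_trans (ler_norm _)).
Qed.

Lemma integral_density_law (f : R -> R) :
  measurable_fun setT f -> (forall x, 0 <= f x) ->
  (\int[G]_x (f x)%:E = \int[lebesgue_measure]_x (f x * g x)%:E)%E.
Proof.
move=> mf f0; rewrite (ge0_integral_density (mu := lebesgue_measure) (w := g))//.
- exact: measurable_pdf.
- exact: pdf_ge0.
- exact/measurable_EFinP.
Qed.

Lemma integral_normal_prob (a : R) (f : R -> R) :
  measurable_fun setT f -> (forall x, 0 <= f x) ->
  (\int[normal_prob a 1]_x (f x)%:E =
   \int[lebesgue_measure]_x (f x * normal_pdf a 1 x)%:E)%E.
Proof.
move=> mf f0.
rewrite (ge0_integral_density (mu := lebesgue_measure) (w := normal_pdf a 1))//.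
- exact: measurable_normal_pdf.
- by move=> x; exact: normal_pdf_ge0.
- exact/measurable_EFinP.
Qed.

Lemma normal_pdf1E (a x : R) :
  normal_pdf a 1 x = normal_peak 1 * expR (- (x - a) ^+ 2 / 2).
Proof. by rewrite normal_pdfE ?oner_neq0// /normal_fun expr1n. Qed.

Lemma normal_pdf1_gt0 (a x : R) : 0 < normal_pdf a 1 x.
Proof. by rewrite normal_pdf1E mulr_gt0 ?expR_gt0// normal_peak_gt0. Qed.

Lemma measurable_normal_pdf1 :
  measurable_fun setT (fun z : measurableTypeR R * measurableTypeR R => normal_pdf z.2 1 z.1).
Proof.
under eq_fun do rewrite normal_pdf1E.
apply: measurable_funM => //; apply: measurableT_comp => //.
apply: measurable_funM => //; apply: measurableT_comp => //.
by apply: measurable_funX; exact: measurable_funB.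
Qed.

Lemma measurable_normal_pdf1_mean (x : R) :
  measurable_fun setT (fun t : measurableTypeR R => normal_pdf t 1 x).
Proof.
apply: (measurableT_comp measurable_normal_pdf1 (g := fun t => (x, t))).
exact: measurable_pair1.
Qed.

(** The convolution of [g] with the standard normal density: the density of one observation whose
    mean is drawn from [g]. *)
Definition slab_marginal (x : R) : R := fine (\int[G]_t (normal_pdf t 1 x)%:E)%E.

Lemma slab_marginalE x :
  (\int[G]_t (normal_pdf t 1 x)%:E = (slab_marginal x)%:E)%E.
Proof.
rewrite /slab_marginal fineK//; apply/fin_numPlt/andP; split.
  apply: (@lt_le_trans _ _ 0%E) => //; apply: integral_ge0 => t _.
  by rewrite lee_fin normal_pdf_ge0.
apply: (@le_lt_trans _ _ (\int[G]_t (normal_peak 1)%:E)%E); last first.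
  by rewrite integral_cst//= probability_setT mule1 ltry.
apply: ge0_le_integral_nomeas => t; rewrite lee_fin ?normal_pdf_ge0//.
by rewrite normal_pdf_ub// oner_neq0.
Qed.

Lemma measurable_slab_marginal : measurable_fun setT slab_marginal.
Proof.
apply: measurableT_comp => //.
apply: (measurable_fun_fubini_tonelli_F (m2 := G)
  (fun z : measurableTypeR R * measurableTypeR R => (normal_pdf z.2 1 z.1)%:E)).
- by apply/measurable_EFinP; exact: measurable_normal_pdf1.
- by move=> z; rewrite lee_fin normal_pdf_ge0.
Qed.

(** All points of the interval are within distance 1 of [a], so there [g] is below [g a] by at most
    the factor [exp (- 2 L)]. *)
Lemma density_law_unit_itv (a b : R) : a <= b + 1 -> b <= a ->
  ((g a * expR (- (2 * L)))%:E <= G `[b, (b + 1)%R]%classic)%E.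
Proof.
move=> ba ab.
rewrite [leRHS](_ : _ = \int[lebesgue_measure]_(t in `[b, (b + 1)%R]) (g t)%:E)%E//.
apply: (@le_trans _ _ (\int[lebesgue_measure]_(t in `[b, (b + 1)%R])
   (g a * expR (- (2 * L)))%:E)%E).
  rewrite integral_cst//= lebesgue_measure_itv/= lte_fin ltrDl ltr01.
  by rewrite -EFinB addrAC subrr add0r mule1.
apply: ge0_le_integral => //.
- by move=> t _; rewrite lee_fin mulr_ge0 ?expR_ge0// ltW// slab_density_gt0.
- by apply/measurable_EFinP; apply: measurable_funTS; exact: measurable_pdf.
move=> t; rewrite /= in_itv/= => /andP[bt tb].
rewrite lee_fin; have := slab_density_lip t a.
rewrite -ler_pdivrMr ?expR_gt0// -expRN => H; apply: le_trans H.
rewrite ler_wpM2l ?(ltW (slab_density_gt0 _))// ler_expR lerN2 [leRHS]mulrC.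
by rewrite ler_wpM2l ?lip_const_ge0// -[leRHS]/(1 + 1) lerD2l ler_norml; lra.
Qed.

Definition marginal_lb : R := expR (- (2 * L) - 2^-1).

Lemma marginal_lb_gt0 : 0 < marginal_lb. Proof. exact: expR_gt0. Qed.

(** Restrict the convolution to a unit interval at [a]: its mass costs [exp (- 2 L)], and moving the
    mean from [a] to a point of it lowers the normal density at [x] by at most [exp (- 1 / 2)]. *)
Lemma slab_marginal_lb a x :
  marginal_lb * g a * normal_pdf a 1 x <= slab_marginal x.
Proof.
rewrite -lee_fin -slab_marginalE.
(* On the unit interval next to [a] on the side of [x], [(x - a) * (t - a) >= 0]. *)
pose b := if a <= x then a else a - 1.
have ba : b <= a by rewrite /b; case: ifP => _; lra.
have ab : a <= b + 1 by rewrite /b; case: ifP => _; lra.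
pose K := normal_pdf a 1 x * expR (- 2^-1).
have K0 : 0 <= K by rewrite mulr_ge0 ?normal_pdf_ge0 ?expR_ge0.
apply: (@le_trans _ _ (\int[G]_(t in `[b, (b + 1)%R]) K%:E)%E).
  rewrite integral_cst//.
  apply: (@le_trans _ _ (K%:E * (g a * expR (- (2 * L)))%:E)%E); last first.
    rewrite lee_wpmul2l ?lee_fin//.
    exact: density_law_unit_itv.
  rewrite -EFinM lee_fin /K /marginal_lb expRD.
  by rewrite le_eqVlt; apply/orP; left; apply/eqP; ring.
rewrite integral_mkcond.
apply: ge0_le_integral_nomeas => t.
  by rewrite patchE; case: ifPn => _; rewrite lee_fin.
rewrite patchE; case: ifPn => [|_]; rewrite lee_fin ?normal_pdf_ge0//.
rewrite inE/= in_itv/= => /andP[bt tb].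
rewrite /K !normal_pdf1E -mulrA -expRD ler_wpM2l ?normal_peak_ge0// ler_expR.
move: bt tb; rewrite /b; case: ifPn => [ax bt tb|]; first by nra.
by rewrite -ltNge => ax bt tb; nra.
Qed.

Lemma slab_marginal_gt0 x : 0 < slab_marginal x.
Proof.
apply: lt_le_trans (slab_marginal_lb x x).
by rewrite !mulr_gt0 ?marginal_lb_gt0 ?slab_density_gt0 ?normal_pdf1_gt0.
Qed.

Definition slab_ratio x := slab_marginal x / normal_pdf 0 1 x.

Lemma slab_ratio_gt0 x : 0 < slab_ratio x.
Proof. by rewrite divr_gt0 ?slab_marginal_gt0 ?normal_pdf1_gt0. Qed.

Lemma measurable_slab_ratio : measurable_fun setT slab_ratio.
Proof.
apply: measurable_funM; first exact: measurable_slab_marginal.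
apply: measurable_ge0_funV; first exact: measurable_normal_pdf.
by move=> x; exact: normal_pdf_ge0.
Qed.

(** The standard normal density cancels against the denominator, and by Tonelli the convolution of
    two probability densities has mass 1. *)
Lemma integral_slab_ratio : (\int[normal_prob 0 1]_x (slab_ratio x)%:E = 1)%E.
Proof.
rewrite integral_normal_prob; last 2 first.
- exact: measurable_slab_ratio.
- by move=> x; exact/ltW/slab_ratio_gt0.
under eq_integral.
  move=> x _; rewrite /slab_ratio divfK; last by rewrite gt_eqF// normal_pdf1_gt0.
  rewrite -slab_marginalE; over.
pose F (z : measurableTypeR R * measurableTypeR R) := (normal_pdf z.2 1 z.1)%:E.
have F0 z : (0 <= F z)%E by rewrite lee_fin normal_pdf_ge0.
have mF : measurable_fun setT F by apply/measurable_EFinP; exact: measurable_normal_pdf1.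
rewrite (fubini_tonelli (m1 := lebesgue_measure) (m2 := G) F mF F0)/=.
under eq_integral do rewrite integral_normal_pdf.
by rewrite integral_cst//= probability_setT mule1.
Qed.

(** The contribution of one coordinate to the slab integral of [exp (- ||theta - theta0||^2 / 4)],
    with [a] the coordinate of [theta0]. *)
Definition slab_gauss (a : R) : R := fine (\int[G]_t (expR (- (t - a) ^+ 2 / 4))%:E)%E.

Lemma measurable_gauss (a b : R) :
  measurable_fun [set: R] (fun t : R => expR (- (t - a) ^+ 2 / b)).
Proof.
apply: measurableT_comp => //; apply: measurable_funM => //.
by apply: measurableT_comp => //; apply: measurable_funX; exact: measurable_funB.
Qed.

Lemma gauss_le1 (a t : R) : expR (- (t - a) ^+ 2 / 4) <= 1.
Proof. by rewrite -expR0 ler_expR mulNr oppr_le0 divr_ge0 ?sqr_ge0. Qed.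

Lemma slab_gaussE a :
  (\int[G]_t (expR (- (t - a) ^+ 2 / 4))%:E = (slab_gauss a)%:E)%E.
Proof.
rewrite /slab_gauss fineK//; apply/fin_numPlt/andP; split.
  by apply: (@lt_le_trans _ _ 0%E) => //; apply: integral_ge0 => t _; rewrite lee_fin expR_ge0.
apply: (@le_lt_trans _ _ (\int[G]_t 1%:E)%E); last first.
  by rewrite integral_cst//= probability_setT mule1 ltry.
by apply: ge0_le_integral_nomeas => t; rewrite lee_fin ?expR_ge0// gauss_le1.
Qed.

Lemma slab_gauss_ge0 a : 0 <= slab_gauss a.
Proof. by rewrite -lee_fin -slab_gaussE integral_ge0// => t _; rewrite lee_fin expR_ge0. Qed.

Lemma slab_gauss_le1 a : slab_gauss a <= 1.
Proof.
rewrite -lee_fin -slab_gaussE.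
apply: (@le_trans _ _ (\int[G]_t 1%:E)%E); last first.
  by rewrite integral_cst//= probability_setT mule1.
by apply: ge0_le_integral_nomeas => t; rewrite lee_fin ?expR_ge0// gauss_le1.
Qed.

Definition slab_gauss_ub : R := expR (L + 2 * L ^+ 2) / normal_peak 2.

Lemma slab_gauss_ub_gt0 : 0 < slab_gauss_ub.
Proof. by rewrite divr_gt0 ?expR_gt0// normal_peak_gt0. Qed.

(** Half of the Gaussian exponent absorbs the growth of [g]: with [y = |t - a|],
    [L y - y^2 / 4 <= 2 L^2 - y^2 / 8]. What remains is an unnormalised density of variance 4. *)
Lemma slab_gauss_le a : slab_gauss a <= slab_gauss_ub * g a.
Proof.
rewrite -lee_fin -slab_gaussE integral_density_law; last 2 first.
- exact: measurable_gauss.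
- by move=> t; exact: expR_ge0.
apply: (@le_trans _ _ (\int[lebesgue_measure]_t
    ((slab_gauss_ub * g a)%:E * (normal_pdf a 2 t)%:E))%E); last first.
  rewrite ge0_integralZl//.
  - by rewrite integral_normal_pdf mule1.
  - by apply/measurable_EFinP; exact: measurable_normal_pdf.
  - by move=> t _; rewrite lee_fin normal_pdf_ge0.
  - by rewrite lee_fin mulr_ge0// ltW ?slab_gauss_ub_gt0 ?slab_density_gt0.
apply: ge0_le_integral_nomeas => t.
  by rewrite lee_fin mulr_ge0 ?expR_ge0// ltW// slab_density_gt0.
rewrite -EFinM lee_fin normal_pdfE ?pnatr_eq0// /normal_fun /slab_gauss_ub.
rewrite (_ : _ * (_ * _) = g a * (expR (L + 2 * L ^+ 2) *
   expR (- (t - a) ^+ 2 / (2 ^+ 2 *+ 2)))); last first.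
  by field; rewrite gt_eqF// normal_peak_gt0.
apply: (@le_trans _ _ (expR (- (t - a) ^+ 2 / 4) * (g a * expR (L * (1 + `|t - a|))))).
  by rewrite ler_wpM2l ?expR_ge0// slab_density_lip.
rewrite mulrCA ler_wpM2l ?(ltW (slab_density_gt0 _))// -!expRD ler_expR.
rewrite -(real_normK (num_real (t - a))); move: `|t - a| => y.
have := sqr_ge0 (y - 4 * L); rewrite (_ : 2 ^+ 2 *+ 2 = 8); last by ring.
nra.
Qed.

Definition zero_gauss_ub : R := expR (L + L ^+ 2) / g 0.

(** The analogue for a coordinate that the model sets to 0: [g 0 <= g a * exp (L (1 + |a|))] and
    [L |a| - a^2 / 4 <= L^2]. *)
Lemma zero_gauss_le a : expR (- (0 - a) ^+ 2 / 4) <= zero_gauss_ub * g a.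
Proof.
rewrite /zero_gauss_ub mulrAC ler_pdivlMr ?slab_density_gt0//.
have := slab_density_lip a 0; rewrite sub0r normrN => /(ler_wpM2l (expR_ge0 _)) H.
apply: (le_trans (H _)); rewrite mulrCA [leRHS]mulrC.
rewrite ler_wpM2l ?(ltW (slab_density_gt0 _))// -expRD ler_expR.
rewrite sqrrN -(real_normK (num_real a)); move: `|a| => y.
have := sqr_ge0 (y - 2 * L); nra.
Qed.

End slab_density.

(** * Integration against finite mixtures *)

Section mixture_integral.
Local Open Scope ereal_scope.

Lemma ge0_integral_mixture d (T : measurableType d) (R : realType) (I : finType)
    (w : I -> R) (m : I -> {measure set T -> \bar R}) (nu : {measure set T -> \bar R})
    (D : set T) (f : T -> \bar R) :
  (forall i, (0 <= w i)%R) ->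
  (forall A, measurable A -> nu A = \sum_i (w i)%:E * m i A) ->
  measurable D -> measurable_fun D f -> (forall x, D x -> 0 <= f x) ->
  \int[nu]_(x in D) f x = \sum_i (w i)%:E * \int[m i]_(x in D) f x.
Proof.
move=> w0 nuE mD mf f0.
pose mix (s : seq I) : {measure set T -> \bar R} :=
  foldr (fun i (acc : {measure set T -> \bar R}) =>
    measure_add (mscale (NngNum (w0 i)) (m i)) acc) mzero s.
have mixE s A : mix s A = \sum_(i <- s) (w i)%:E * m i A.
  elim: s => [|i s IH]; first by rewrite big_nil.
  by rewrite big_cons -IH; exact: measure_addE.
rewrite (eq_measure_integral (mix (index_enum I))); last first.
  by move=> A mA _; rewrite nuE// mixE.
elim: (index_enum I) => [|i s IH]; first by rewrite big_nil integral_measure_zero.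
by rewrite big_cons /= ge0_integral_measure_add// -IH ge0_integral_mscale.
Qed.

End mixture_integral.

(** * The posterior as a mixture over models *)

Section posterior_bound.
Context (R : realType) (n : nat) (pi : dim_prior R n) (g : density R).
Implicit Types (x theta : Rvec R n) (S : {set 'I_n}).

Let G : probability (measurableTypeR R) R := density_law g.
Let Pi : probability (Rvec R n) R := prior pi (slab_law g).

(** The prior mass of one single model of size [k]; the binomial coefficient accounts for the
    uniform choice among models of that size. *)
Definition model_weight (k : nat) : R := pi k / 'C(n, k)%:R.

Lemma card_set_le S : (#|S| <= n)%N.
Proof. by rewrite -[X in (_ <= X)%N]card_ord max_card. Qed.

Lemma model_weight_gt0 k : (k <= n)%N -> 0 < model_weight k.
Proof.
by move=> kn; rewrite divr_gt0 ?dim_weight_gt0// ltr0n bin_gt0.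
Qed.

Lemma model_weight_ge0 S : 0 <= model_weight #|S|.
Proof. by rewrite ltW// model_weight_gt0// card_set_le. Qed.

Lemma sum_by_card (V : nmodType) (F : {set 'I_n} -> V) :
  \sum_(S : {set 'I_n}) F S = \sum_(k < n.+1) \sum_(S : {set 'I_n} | #|S| == k) F S.
Proof.
rewrite (partition_big (fun S : {set 'I_n} => inord #|S| : 'I_n.+1) xpredT)//=.
apply: eq_bigr => k _; apply: eq_bigl => S.
by rewrite -val_eqE/= inordK// ltnS card_set_le.
Qed.

Lemma prior_mixtureE (H : {set 'I_n} -> probability (Rvec R n) R) (B : set (Rvec R n)) :
  prior pi H B = (\sum_(S : {set 'I_n}) (model_weight #|S|)%:E * H S B)%E.
Proof.
rewrite sum_by_card /prior; apply: eq_bigr => k _.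
rewrite ge0_sume_distrr; last first.
  by move=> S _; rewrite mule_ge0// lee_fin invr_ge0.
by apply: eq_bigr => S /eqP ->; rewrite muleA -EFinM.
Qed.

Lemma model_weight_sum : \sum_(S : {set 'I_n}) model_weight #|S| = 1.
Proof.
apply: EFin_inj; transitivity (Pi setT); last exact: probability_setT.
rewrite /Pi/= prior_mixtureE -sumEFin; apply: eq_bigr => S _.
by rewrite probability_setT mule1.
Qed.

Lemma measurable_normal_density x :
  measurable_fun setT (fun theta => normal_density theta x).
Proof.
apply: (measurable_prod_tnth (f := fun i t => normal_pdf t 1 (tnth x i))).
by move=> i; exact: measurable_normal_pdf1_mean.
Qed.

Lemma normal_density_gt0 theta x : 0 < normal_density theta x.
Proof. by apply: prodr_gt0 => i _; exact: normal_pdf1_gt0. Qed.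

Lemma integral_dirac0 (f : R -> R) : measurable_fun setT f ->
  (\int[\d_(0%R : measurableTypeR R)]_t (f t)%:E = (f 0)%:E)%E.
Proof.
move=> mf; rewrite integral_dirac//; last exact/measurable_EFinP.
by rewrite diracT mul1e.
Qed.

Lemma integral_slab_law_prod S (f : 'I_n -> R -> R) (c : 'I_n -> R) :
  (forall i, measurable_fun setT (f i)) -> (forall i t, 0 <= f i t) ->
  (forall i, i \in S -> \int[G]_t (f i t)%:E = (c i)%:E)%E ->
  (\int[slab_law g S]_theta (\prod_i f i (tnth theta i))%:E =
   (\prod_i (if i \in S then c i else f i 0))%:E)%E.
Proof.
move=> mf f0 fc; apply: integral_product_law_prod => // i.
by case: ifPn => iS; [exact: fc|exact: integral_dirac0].
Qed.

Let off_support_boxE S :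
  [set theta : Rvec R n | forall i, i \notin S -> tnth theta i = 0] =
  [set theta : Rvec R n | forall i, (if i \in S then setT else [set 0]) (tnth theta i)].
Proof.
apply/seteqP; split=> theta /= H i; first by case: ifPn => // iS; exact: H.
by move=> iS; have := H i; rewrite (negbTE iS).
Qed.

Lemma slab_law_off_support S :
  slab_law g S [set theta : Rvec R n | forall i, i \notin S -> tnth theta i = 0] = 1%E.
Proof.
rewrite off_support_boxE.
pose A i : set (measurableTypeR R) := if i \in S then setT else [set 0].
have mA i : measurable (A i) by rewrite /A; case: ifP.
apply: (eq_trans (product_law_box _ mA)); apply: big1 => i _.
rewrite /A; case: ifPn => iS; first exact: probability_setT.
by rewrite /= diracE mem_set.
Qed.

Lemma measurable_off_support S :
  measurable [set theta : Rvec R n | forall i, i \notin S -> tnth theta i = 0].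
Proof.
rewrite off_support_boxE (_ : [set _ | _] = \big[setI/setT]_(i < n)
    ((fun theta : Rvec R n => tnth theta i) @^-1`
     (if i \in S then setT else [set (0 : measurableTypeR R)]))).
  apply: bigsetI_measurable => i _; rewrite -[X in measurable X]setTI.
  by apply: measurable_tnth => //; case: ifP.
rewrite -bigcap_seq; apply/seteqP; split=> theta /= H i.
  by move=> _; exact: H.
by apply: H; rewrite /= mem_index_enum.
Qed.

Lemma slab_law_ae_off_support S :
  {ae slab_law g S, forall theta : Rvec R n, forall i, i \notin S -> tnth theta i = 0}.
Proof.
exists (~` [set theta : Rvec R n | forall i, i \notin S -> tnth theta i = 0]); split.
- by apply: measurableC; exact: measurable_off_support.
- rewrite probability_setC; last exact: measurable_off_support.
  by rewrite slab_law_off_support subee.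
- by move=> theta /=.
Qed.

Definition model_density x S : R :=
  \prod_i (if i \in S then slab_marginal g (tnth x i) else normal_pdf 0 1 (tnth x i)).

Lemma integral_slab_law_density x S :
  (\int[slab_law g S]_theta (normal_density theta x)%:E = (model_density x S)%:E)%E.
Proof.
rewrite (integral_slab_law_prod (f := fun i t => normal_pdf t 1 (tnth x i))
  (c := fun i => slab_marginal g (tnth x i)))//.
- by move=> i; exact: measurable_normal_pdf1_mean.
- by move=> i t; exact: normal_pdf_ge0.
- by move=> i _; exact: slab_marginalE.
Qed.

Definition evidence x : R := \sum_(S : {set 'I_n}) model_weight #|S| * model_density x S.

Lemma integral_prior_density x (B : set (Rvec R n)) : measurable B ->
  (\int[Pi]_(theta in B) (normal_density theta x)%:E =
   \sum_(S : {set 'I_n}) (model_weight #|S|)%:E *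
     \int[slab_law g S]_(theta in B) (normal_density theta x)%:E)%E.
Proof.
move=> mB; rewrite (ge0_integral_mixture (w := fun S => model_weight #|S|)
  (m := fun S => slab_law g S))//.
- by move=> S; exact: model_weight_ge0.
- by move=> A mA; rewrite /Pi/= prior_mixtureE.
- by apply/measurable_EFinP; apply: measurable_funTS; exact: measurable_normal_density.
- by move=> theta _; rewrite lee_fin ltW// normal_density_gt0.
Qed.

Lemma integral_prior_densityT x :
  (\int[Pi]_theta (normal_density theta x)%:E = (evidence x)%:E)%E.
Proof.
rewrite integral_prior_density// /evidence -sumEFin; apply: eq_bigr => S _.
by rewrite integral_slab_law_density.
Qed.

(** The prior is a finite mixture of slab laws, so the numerator can be bounded model by model. The
    bound also shows it to be finite, so that [fine] does no harm. *)
Lemma posterior_le x (B : set (Rvec R n)) (b : {set 'I_n} -> R) : measurable B ->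
  0 < evidence x ->
  (forall S, \int[slab_law g S]_(theta in B) (normal_density theta x)%:E <= (b S)%:E)%E ->
  posterior Pi x B <= (\sum_(S : {set 'I_n}) model_weight #|S| * b S) / evidence x.
Proof.
move=> mB ev0 Bb; rewrite /posterior integral_prior_densityT/=.
rewrite ler_pM2r ?invr_gt0//.
have B0 : (0 <= \int[Pi]_(theta in B) (normal_density theta x)%:E)%E.
  by apply: integral_ge0 => theta _; rewrite lee_fin ltW// normal_density_gt0.
have BE : (\int[Pi]_(theta in B) (normal_density theta x)%:E <=
    (\sum_(S : {set 'I_n}) model_weight #|S| * b S)%:E)%E.
  rewrite integral_prior_density// -sumEFin; apply: lee_sum => S _.
  by rewrite [leRHS]EFinM lee_wpmul2l// lee_fin model_weight_ge0.
rewrite -lee_fin fineK//; apply/fin_numPlt/andP; split.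
  exact: lt_le_trans B0.
by apply: le_lt_trans BE _; rewrite ltry.
Qed.

Lemma integral_slab_law_density_subset x S (B : set (Rvec R n)) : measurable B ->
  (\int[slab_law g S]_(theta in B) (normal_density theta x)%:E <= (model_density x S)%:E)%E.
Proof.
move=> mB; rewrite -integral_slab_law_density; apply: ge0_subset_integral => //.
- by apply/measurable_EFinP; exact: measurable_normal_density.
- by move=> theta _; rewrite lee_fin ltW// normal_density_gt0.
Qed.

Lemma posterior_ge0 x (B : set (Rvec R n)) : 0 <= posterior Pi x B.
Proof.
by rewrite divr_ge0// fine_ge0// integral_ge0// => theta _;
  rewrite lee_fin ltW// normal_density_gt0.
Qed.

Lemma posterior_le1 x (B : set (Rvec R n)) : measurable B -> 0 < evidence x ->
  posterior Pi x B <= 1.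
Proof.
move=> mB ev0; apply: (le_trans (posterior_le mB ev0 _)) => [S|].
  exact: integral_slab_law_density_subset.
by rewrite -/(evidence x) divff// gt_eqF.
Qed.

End posterior_bound.

(** * Posterior mass of the large models *)

Section dimension_reduction.
Context (R : realType) (n : nat) (pi : dim_prior R n) (g : density R).
Variables (h : R -> R) (L : R).
Hypothesis g_exp : forall x, g x = expR (h x).
Hypothesis h_lip : forall x y, `|h x - h y| <= L * (1 + `|x - y|).
Implicit Types (x theta : Rvec R n) (S : {set 'I_n}).

Let w := model_weight pi.
Let rho0 := slab_ratio_gt0 g_exp h_lip.

Definition ratio_vec x : 'I_n -> R := fun i => slab_ratio g (tnth x i).

Definition null_density x : R := \prod_i normal_pdf 0 1 (tnth x i).

Lemma null_density_gt0 x : 0 < null_density x.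
Proof. by apply: prodr_gt0 => i _; exact: normal_pdf1_gt0. Qed.

Lemma model_densityE x S :
  model_density g x S = null_density x * \prod_(i in S) ratio_vec x i.
Proof.
rewrite /model_density /null_density [X in _ * X]big_mkcond/= -big_split/=.
apply: eq_bigr => i _; case: ifPn => _; last by rewrite mulr1.
by rewrite /ratio_vec /slab_ratio mulrC divfK// gt_eqF// normal_pdf1_gt0.
Qed.

Lemma coef_esym_poly_gt0 (I : finType) (P : pred I) (y : I -> R) k :
  (forall i, 0 < y i) -> (k <= #|P|)%N -> 0 < (esym_poly P y)`_k.
Proof.
move=> y0; rewrite -sum1_card /esym_poly => kP.
have: (forall l, (0 <= (\prod_(i | P i) (1 + y i *: 'X : {poly R}))`_l)) /\
    (forall l, (l <= \sum_(i | P i) 1)%N -> 0 < (\prod_(i | P i) (1 + y i *: 'X : {poly R}))`_l).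
  elim/big_rec2: _ => [|i m Q _ [IH0 IH]].
    by split=> [l|[|l]]//; rewrite coef1 ?ltr01//; case: eqP.
  split=> [l|[_|l lm]]; rewrite coef_mul_linear.
  - by case: l => [|l]; rewrite ?mulr0 ?addr0 ?addr_ge0// mulr_ge0// ltW.
  - by rewrite mulr0 addr0 IH.
  - by rewrite ltr_wpDl// mulr_gt0// IH.
by case=> _; exact.
Qed.

Variables (S1 : {set 'I_n}) (s j T : nat).
Hypotheses (S1s : #|S1| = s) (sj : (s + j <= n)%N) (sT : (s <= T)%N).

Definition off_poly x : {poly R} := esym_poly (predC (mem S1)) (ratio_vec x).

Lemma card_off : #|predC (mem S1)| = (n - s)%N.
Proof. have E : (s + #|predC (mem S1)|)%N = n.
  by have := cardC (mem S1); rewrite card_ord S1s.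
by apply/eqP; rewrite -(eqn_add2l s) E subnKC// -[X in (_ <= X)%N]E leq_addr.
Qed.

Lemma off_poly_gt0 x : 0 < (off_poly x)`_j.
Proof.
by apply: coef_esym_poly_gt0 => [i|]; [exact: rho0|rewrite card_off leq_subRL//; lia].
Qed.

(** Here [a] is the number of coordinates of a model inside [S1]. Models of size [k] are compared
    with those of size [a + j] that have the same coordinates inside [S1]. *)
Definition dim_ratio x : R := \sum_(a < s.+1) \sum_(k < n.+1 | (T < k)%N)
  w k / w (a + j) * ((off_poly x)`_(k - a) / (off_poly x)`_j).

Lemma evidence_polyE x (P : pred nat) :
  \sum_(S : {set 'I_n} | P #|S|) w #|S| * model_density g x S =
  null_density x * \sum_(k < n.+1 | P k) w k * (esym_poly xpredT (ratio_vec x))`_k.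
Proof.
under eq_bigr do rewrite model_densityE mulrCA.
rewrite -big_distrr/= big_mkcond sum_by_card [in RHS]big_mkcond/=; congr (_ * _).
apply: eq_bigr => k _; rewrite coef_esym_poly.
case: ifPn => Pk; last by apply: big1 => S /eqP ->; rewrite (negbTE Pk).
by rewrite big_distrr/=; apply: eq_bigr => S /eqP ->; rewrite Pk.
Qed.

Lemma evidence_gt0 x : 0 < evidence pi g x.
Proof.
rewrite /evidence (bigD1 (finset.set0 : {set 'I_n}))//= ltr_pwDl//.
  rewrite mulr_gt0 ?model_weight_gt0 ?card_set_le// model_densityE.
  by rewrite mulr_gt0 ?null_density_gt0// big_set0.
apply: sumr_ge0 => S _; rewrite mulr_ge0 ?model_weight_ge0// model_densityE.
rewrite mulr_ge0 ?ltW ?null_density_gt0// prodr_gt0// => i _; exact: rho0.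
Qed.

(** Splitting the generating polynomial as [al * e], inside and outside [S1], writes the numerator
    as [\sum_a al_a X_a], while the evidence is at least [\sum_a al_a Y_a]. The quotient is then at
    most the sum of the [X_a / Y_a]. *)
Lemma large_models_le x :
  (\sum_(S : {set 'I_n} | (T < #|S|)%N) w #|S| * model_density g x S) /
    evidence pi g x <= dim_ratio x.
Proof.
rewrite ler_pdivrMr ?evidence_gt0//.
rewrite /evidence (evidence_polyE x (fun k => T < k)%N) (evidence_polyE x xpredT).
rewrite mulrCA ler_wpM2l ?(ltW (null_density_gt0 _))//.
set e := off_poly x; have e_gt0 : 0 < e`_j := off_poly_gt0 x.
pose al := esym_poly (mem S1) (ratio_vec x).
have -> : esym_poly xpredT (ratio_vec x) = al * e by rewrite (esym_polyID (mem S1)).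
have rge0 i : 0 <= ratio_vec x i by apply: ltW; exact: rho0.
have al0 a : 0 <= al`_a by exact: coef_esym_poly_ge0.
have e0 a : 0 <= e`_a by exact: coef_esym_poly_ge0.
have als a : (s < a)%N -> al`_a = 0.
  by move=> sa; apply: nth_default; rewrite (leq_trans (size_esym_poly _ _))//= S1s.
have w0 k : (k <= n)%N -> 0 < w k by exact: model_weight_gt0.
pose X (a : nat) := \sum_(k < n.+1 | (T < k)%N) w k * e`_(k - a).
pose Y (a : nat) := w (a + j)%N * e`_j.
have Y0 (a : 'I_s.+1) : 0 < Y a by rewrite mulr_gt0// w0//; have := ltn_ord a; lia.
have X0 a : 0 <= X a.
  by apply: sumr_ge0 => k _; rewrite mulr_ge0// ltW// w0// -ltnS.
have -> : dim_ratio x = \sum_(a < s.+1) X a / Y a.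
  apply: eq_bigr => a _; rewrite /X big_distrl/=; apply: eq_bigr => k _.
  by rewrite -/e /Y [(w _ * e`_j)^-1]invfM mulrACA.
have dr0 : 0 <= \sum_(a < s.+1) X a / Y a.
  by apply: sumr_ge0 => a _; rewrite divr_ge0// ltW.
apply: (@le_trans _ _ (\sum_(a < s.+1) al`_a * X a)).
  rewrite le_eqVlt; apply/orP; left; apply/eqP.
  under [RHS]eq_bigr do rewrite /X big_distrr/=.
  rewrite exchange_big/=; apply: eq_bigr => k Tk.
  rewrite coefM big_distrr/= -(big_mkord xpredT (fun a => w k * (al`_a * e`_(k - a)))).
  (* The convolution sum is cut at [s], the bound on the degree of [al]; this is possible since
     [s <= T < k]. *)
  rewrite (@big_cat_nat _ _ _ s.+1)//=; last by lia.
  rewrite [X in _ + X]big_nat_cond [X in _ + X]big1 ?addr0; last first.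
    by move=> a /andP[/andP[sa _] _]; rewrite als// mul0r mulr0.
  by rewrite big_mkord; apply: eq_bigr => a _; rewrite mulrCA.
apply: (@le_trans _ _ ((\sum_(a < s.+1) X a / Y a) * \sum_(a < s.+1) al`_a * Y a)).
  rewrite big_distrr/=; apply: ler_sum => a _.
  rewrite mulrCA ler_wpM2l// -ler_pdivrMr// (bigD1 a)//= lerDl.
  by apply: sumr_ge0 => b _; rewrite divr_ge0// ltW.
rewrite ler_wpM2l//.
have term k : (k < n.+1)%N -> 0 <= w k * (al * e)`_k.
  move=> kn; rewrite mulr_ge0 ?(ltW (w0 _ _))// coefM sumr_ge0// => i _.
  by rewrite mulr_ge0.
rewrite -(big_mkord xpredT (fun k => w k * (al * e)`_k)).
(* Of the evidence, only the sizes [a + j] with [a <= s] are kept, and then, in each coefficient,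
   only the term of degree [j] outside [S1]. *)
rewrite (@big_cat_nat _ _ _ j)//=; last by lia.
rewrite (@big_cat_nat _ _ _ (s.+1 + j) j)//=; [|lia].
rewrite addrCA ler_wpDr//.
  by rewrite addr_ge0// big_nat_cond sumr_ge0// => k; rewrite andbT => /andP[_ kn];
    apply: term; lia.
rewrite -[X in \sum_(X <= _ < _) _]add0n big_addn addnK big_mkord; apply: ler_sum => a _.
rewrite /Y mulrCA ler_wpM2l ?(ltW (w0 _ _))//; first by have := ltn_ord a; lia.
have ja : (a < (a + j).+1)%N by lia.
rewrite coefM (bigD1 (Ordinal ja))//= addKn lerDl.
by apply: sumr_ge0 => b _; rewrite mulr_ge0.
Qed.

End dimension_reduction.

(** * Expected mass of the large models *)

Section dimension_expectation.
Context (R : realType) (n : nat) (pi : dim_prior R n) (g : density R).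
Variables (h : R -> R) (L : R).
Hypothesis g_exp : forall x, g x = expR (h x).
Hypothesis h_lip : forall x y, `|h x - h y| <= L * (1 + `|x - y|).

Let w := model_weight pi.
Let rho0 := slab_ratio_gt0 g_exp h_lip.

Variables (S1 : {set 'I_n}) (s j T : nat).
Hypotheses (S1s : #|S1| = s) (sj : (s + j <= n)%N) (sT : (s + j <= T)%N).

Lemma coef_one_addX_exp N k : (((1 : {poly R}) + 'X) ^+ N)`_k = 'C(N, k)%:R.
Proof.
elim: N k => [|N IH] k; first by rewrite expr0 coef1 bin0n.
rewrite exprS; have := @coef_mul_linear R 1 ((1 + 'X) ^+ N) k.
rewrite scale1r mul1r => ->.
by case: k => [|k]; rewrite !IH ?addr0 ?bin0// binS natrD.
Qed.

Lemma measurable_off_poly k : measurable_fun setT (fun x => (off_poly g S1 x)`_k).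
Proof.
under eq_fun do rewrite -[off_poly _ _ _]mulr1.
apply: (@measurable_coef_esym_poly _ _ _ _ _ (fun i x => slab_ratio g (tnth x i))).
move=> i; apply: (measurableT_comp (measurable_slab_ratio g)); exact: measurable_tnth.
Qed.

Lemma off_poly_ge0 x k : 0 <= (off_poly g S1 x)`_k.
Proof. by apply: coef_esym_poly_ge0 => i; apply: ltW; exact: rho0. Qed.

Let term_ge0 x a k : (a < s.+1)%N -> (k < n.+1)%N ->
  0 <= w k / w (a + j) * ((off_poly g S1 x)`_(k - a) / (off_poly g S1 x)`_j).
Proof.
move=> sa kn; rewrite mulr_ge0// divr_ge0 ?off_poly_ge0//; apply: ltW;
  apply: model_weight_gt0; lia.
Qed.

Lemma measurable_dim_ratio : measurable_fun setT (dim_ratio pi g S1 s j T).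
Proof.
apply: measurable_sum => a; rewrite /=.
under eq_fun do rewrite big_mkcond/=.
apply: measurable_sum => k; case: (T < k)%N => //.
apply: measurable_funM => //; apply: measurable_funM; first exact: measurable_off_poly.
apply: measurable_ge0_funV => [|x]; [exact: measurable_off_poly|exact: off_poly_ge0].
Qed.

(** Outside [S1] the observations are standard normal, so the ratios are bounded by their values at
    [rho = 1], where the generating polynomial is [(1 + X)^(n - s)]. *)
Lemma integral_dim_ratio (theta0 : Rvec R n) :
  (forall i, i \notin S1 -> tnth theta0 i = 0) ->
  (\int[normal_law theta0]_x (dim_ratio pi g S1 s j T x)%:E <=
   (\sum_(a < s.+1) \sum_(k < n.+1 | (T < k)%N)
     w k / w (a + j) * ('C(n - s, k - a)%:R / 'C(n - s, j)%:R))%:E)%E.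
Proof.
move=> off0; rewrite /dim_ratio.
under eq_integral do rewrite -sumEFin.
rewrite ge0_integral_sum//; last 2 first.
- move=> a; apply/measurable_EFinP.
  under eq_fun do rewrite big_mkcond/=.
  apply: measurable_sum => k; case: (T < k)%N => //.
  apply: measurable_funM => //; apply: measurable_funM; first exact: measurable_off_poly.
  apply: measurable_ge0_funV => [|x]; [exact: measurable_off_poly|exact: off_poly_ge0].
- by move=> a x _; rewrite lee_fin sumr_ge0// => k _; exact: term_ge0.
rewrite -[leRHS]sumEFin; apply: lee_sum => a _.
under eq_integral do rewrite -sumEFin big_mkcond/=.
rewrite ge0_integral_sum//; last 2 first.
- move=> k; case: (T < k)%N => //; apply/measurable_EFinP.
  apply: measurable_funM => //; apply: measurable_funM; first exact: measurable_off_poly.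
  apply: measurable_ge0_funV => [|x]; [exact: measurable_off_poly|exact: off_poly_ge0].
- by move=> k x _; case: ifP => // _; rewrite lee_fin term_ge0.
rewrite [X in (_ <= X%:E)%E]big_mkcond/= -[leRHS]sumEFin; apply: lee_sum => k _.
case: ifPn => Tk; last by rewrite integral0.
under eq_integral do rewrite EFinM.
have wk0 : 0 <= w k / w (a + j).
  have ka := ltn_ord a; have kk := ltn_ord k.
  by rewrite divr_ge0//; apply: ltW; apply: model_weight_gt0; lia.
rewrite ge0_integralZl//; last 2 first.
- apply/measurable_EFinP; apply: measurable_funM; first exact: measurable_off_poly.
  apply: measurable_ge0_funV => [|x]; [exact: measurable_off_poly|exact: off_poly_ge0].
- by move=> x _; rewrite lee_fin divr_ge0// off_poly_ge0.
rewrite [leRHS]EFinM lee_wpmul2l ?lee_fin//.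
under eq_integral => x _ do rewrite -[off_poly g S1 x]mulr1.
apply: (le_trans (integral_esym_ratio (measurable_slab_ratio g) rho0 _ _ _ _)).
- by move=> i /= iS; rewrite off0// (integral_slab_ratio g_exp h_lip).
- exact: log_concave1.
(* The ratio needs [j <= k - a], which follows from [s + j <= T < k] and [a <= s]. *)
- by have := ltn_ord a; lia.
- by rewrite mulr1 coef_one_addX_exp (card_off S1s) ltr0n bin_gt0; lia.
by rewrite mulr1 !coef_one_addX_exp (card_off S1s).
Qed.

Variables (D D' : R).
Hypotheses (D_ge0 : 0 <= D) (D'_ge0 : 0 <= D') (D'_lt1 : D' < 1) (j_gt0 : (0 < j)%N).
Hypothesis pi_decr : forall k, (j < k <= n)%N -> pi k <= D * pi k.-1.
Hypothesis DD' : D * (1 + s%:R / j%:R) <= D'.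

(** The two binomial quotients multiply to [(n - s - k) / (n - a - k)], at most 1 as [a <= s], times
    [(a + k + 1) / (k + 1)], at most [1 + s / j] as [j <= k]. The rest is the decrease of [pi]. *)
Lemma weight_binomial_step a k : (a <= s)%N -> (j <= k)%N -> (a + k < n)%N ->
  w (a + k).+1 * 'C(n - s, k.+1)%:R <= D' * (w (a + k) * 'C(n - s, k)%:R).
Proof.
move=> sa jk akn; rewrite /w /model_weight.
have := pi_decr (_ : (j < (a + k).+1 <= n)%N); rewrite /= => /(_ _).
have -> : (j < (a + k).+1 <= n)%N by lia.
move=> /(_ isT) piD.
have C0 l : (l <= n)%N -> 0 < 'C(n, l)%:R :> R by move=> ln; rewrite ltr0n bin_gt0.
have E1 : k.+1%:R * 'C(n - s, k.+1)%:R = (n - s - k)%:R * 'C(n - s, k)%:R :> R.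
  by rewrite -!natrM mul_bin_left.
have E2 : (a + k).+1%:R * 'C(n, (a + k).+1)%:R = (n - (a + k))%:R * 'C(n, a + k)%:R :> R.
  by rewrite -!natrM mul_bin_left.
have k0 : 0 < k.+1%:R :> R by rewrite ltr0n.
have nak0 : 0 < (n - (a + k))%:R :> R by rewrite ltr0n subn_gt0.
have -> : 'C(n - s, k.+1)%:R = (n - s - k)%:R * 'C(n - s, k)%:R / k.+1%:R :> R.
  by rewrite -E1 mulrAC divff ?mul1r// gt_eqF.
have -> : ('C(n, (a + k).+1)%:R : R)^-1 =
    (a + k).+1%:R / ((n - (a + k))%:R * 'C(n, a + k)%:R).
  by rewrite -E2 invfM mulrA divff ?mul1r// pnatr_eq0.
have pi0 : 0 < pi (a + k)%N by apply: dim_weight_gt0; lia.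
set c := 'C(n, a + k)%:R; have c0 : 0 < c by apply: C0; lia.
set b := 'C(n - s, k)%:R; have b0 : 0 <= b by rewrite ler0n.
have H1 : (n - s - k)%:R / (n - (a + k))%:R <= 1 :> R.
  by rewrite ler_pdivrMr// mul1r ler_nat; lia.
have H2 : (a + k).+1%:R / k.+1%:R <= 1 + s%:R / j%:R :> R.
  rewrite -addnS natrD mulrDl divff ?gt_eqF// addrC lerD2l.
  rewrite ler_pM// ?invr_ge0 ?ler0n ?ler_nat// lef_pV2 ?posrE ?ltr0n// ler_nat; lia.
pose r1 : R := (n - s - k)%:R / (n - (a + k))%:R.
pose r2 : R := (a + k).+1%:R / k.+1%:R.
have -> : pi (a + k).+1 * ((a + k).+1%:R / ((n - (a + k))%:R * c)) *
    ((n - s - k)%:R * b / k.+1%:R) = pi (a + k).+1 * (r1 * r2) * (b / c).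
  by rewrite /r1 /r2; field; rewrite !gt_eqF.
have -> : D' * (pi (a + k)%N / c * b) = (D' * pi (a + k)%N) * (b / c) by ring.
apply: ler_wpM2r; first by rewrite divr_ge0// ltW.
have r10 : 0 <= r1 by rewrite divr_ge0 ?ler0n.
have r20 : 0 <= r2 by rewrite divr_ge0 ?ler0n.
apply: (@le_trans _ _ (D * pi (a + k)%N * (1 * (1 + s%:R / j%:R)))).
  by apply: ler_pM => //; rewrite ?mulr_ge0// ?ler_pM//;
    apply/ltW/dim_weight_gt0.
by rewrite mul1r mulrAC ler_wpM2r// ltW.
Qed.

Lemma weight_binomial_geometric a i : (a <= s)%N -> (a + j + i <= n)%N ->
  w (a + j + i) * 'C(n - s, j + i)%:R <= D' ^+ i * (w (a + j) * 'C(n - s, j)%:R).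
Proof.
move=> sa; elim: i => [|i IH] aji; first by rewrite !addn0 expr0 mul1r.
rewrite !addnS -!addnA; apply: le_trans (weight_binomial_step sa _ _) _; try lia.
rewrite exprS -mulrA ler_wpM2l// !addnA; apply: IH; lia.
Qed.

Lemma geometric_tail_le (y : R) m : 0 <= y -> y < 1 ->
  \sum_(k < m | (T < k)%N) y ^+ (k - T) <= (1 - y)^-1.
Proof.
move=> y0 y1; rewrite -[leRHS]mul1r ler_pdivlMr ?subr_gt0//.
(* A sharper bound that survives induction on [m]; for [m <= T] the truncated difference makes it
   0. *)
apply: (@le_trans _ _ (1 - y ^+ (m - T))); last first.
  by rewrite lerBlDr lerDl exprn_ge0.
elim: m => [|m IH]; first by rewrite big_ord0 mul0r sub0n expr0 subrr.
rewrite big_mkcond big_ord_recr -big_mkcond/= mulrDl.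
case: ifPn => Tm.
  rewrite subSn; last by lia.
  move: IH; rewrite exprS; move: (y ^+ (m - T)) (\sum_(_ < _ | _) _) => b S; lra.
rewrite mul0r addr0; apply: le_trans IH _; rewrite lerD2l lerN2.
by apply: ler_wiXn2l => //; [exact: ltW|lia].
Qed.

(** Going from size [a + j] to [k] takes [k - a - j >= s + (k - T)] steps, since [a <= s] and
    [T >= 2 s + j]. Each of the [s + 1] values of [a] thus gives [D' ^+ s] times a geometric
    tail. *)
Lemma sum_dim_ratio_le : (s + s + j <= T)%N ->
  \sum_(a < s.+1) \sum_(k < n.+1 | (T < k)%N)
     w k / w (a + j) * ('C(n - s, k - a)%:R / 'C(n - s, j)%:R)
  <= s.+1%:R * (D' ^+ s / (1 - D')).
Proof.
move=> ssjT.
apply: (@le_trans _ _ (\sum_(a < s.+1) D' ^+ s / (1 - D'))); last first.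
  by rewrite sumr_const card_ord mulr_natl.
apply: ler_sum => a _; have as1 := ltn_ord a.
apply: (@le_trans _ _ (\sum_(k < n.+1 | (T < k)%N) D' ^+ s * D' ^+ (k - T))); last first.
  by rewrite -big_distrr/= ler_wpM2l ?exprn_ge0// geometric_tail_le.
apply: ler_sum => k Tk; have kn := ltn_ord k.
have wj : 0 < w (a + j) by apply: model_weight_gt0; lia.
have Cj : 0 < 'C(n - s, j)%:R :> R by rewrite ltr0n bin_gt0; lia.
have -> : w k / w (a + j) * ('C(n - s, k - a)%:R / 'C(n - s, j)%:R) =
   (w k * 'C(n - s, k - a)%:R) / (w (a + j) * 'C(n - s, j)%:R).
  by rewrite [(w (a + j) * _)^-1]invfM mulrACA.
rewrite (ler_pdivrMr _ _ (mulr_gt0 wj Cj)).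
have as' : (a <= s)%N by [].
have ajk : (a + j + (k - a - j) <= n)%N by lia.
have := weight_binomial_geometric as' ajk.
rewrite (_ : (a + j + (k - a - j))%N = k); last by lia.
rewrite (_ : (j + (k - a - j))%N = (k - a)%N); last by lia.
move=> /le_trans; apply.
apply: ler_wpM2r; first by apply/ltW/mulr_gt0.
rewrite -exprD.
by apply: ler_wiXn2l => //; [exact: ltW|lia].
Qed.

End dimension_expectation.

(** * Comparison of [dq] with the Euclidean distance *)

Section distance.
Context (R : realType).

(** For [z = y / t], [z^q] is at most 1 if [z <= 1], and at most [z^2] otherwise. *)
Lemma powR_le_quadratic (q t y : R) : 0 < q -> q <= 2 -> 0 < t -> 0 <= y ->
  y `^ q <= t `^ q * (1 + y ^+ 2 / t ^+ 2).
Proof.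
move=> q0 q2 t0 y0; have tq := powR_ge0 t q.
have y2 : 0 <= y ^+ 2 / t ^+ 2 by rewrite divr_ge0 ?sqr_ge0.
have [yt|ty] := leP y t.
  apply: (@le_trans _ _ (t `^ q)); last by rewrite ler_peMr// lerDl.
  by apply: ge0_ler_powR; rewrite ?nnegrE//; apply: ltW.
have yE : y = t * (y / t) by rewrite mulrC divfK// gt_eqF.
rewrite {1}yE powRM ?divr_ge0//; try exact: ltW.
rewrite ler_wpM2l// -expr_div_n.
apply: (@le_trans _ _ ((y / t) `^ 2)).
  by apply: ler_powR => //; rewrite ler_pdivlMr// mul1r ltW.
by rewrite powR_mulrn ?lerDr// divr_ge0// ltW.
Qed.

(** The rate is the [dq] size of a vector with [s] entries equal to [r / sqrt s], the natural scale
    for one coordinate. *)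
Lemma powR_rate (q r s : R) : 0 < r -> 0 < s ->
  r `^ q * s `^ (1 - q / 2) = s * (r / Num.sqrt s) `^ q.
Proof.
move=> r0 s0; have ss : 0 < Num.sqrt s by rewrite sqrtr_gt0.
have -> : s `^ (1 - q / 2) = s / Num.sqrt s `^ q.
  rewrite powRB; last by rewrite (gt_eqF s0) implybT.
  by rewrite (powRr1 (ltW s0)) [q / 2]mulrC powRrM (powR12_sqrt (ltW s0)).
have rE : r `^ q = (r / Num.sqrt s) `^ q * Num.sqrt s `^ q.
  by rewrite -powRM ?(ltW ss) ?ltW ?divr_gt0// divfK// gt_eqF.
rewrite rE; field; rewrite gt_eqF// powR_gt0//.
Qed.

(** By contraposition: with [t = r / sqrt s], summing [powR_le_quadratic] over [U] bounds [dq] by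
    [t^q (m s + ||u||^2 / t^2)], and [||u||^2 <= M' r^2] means [||u||^2 / t^2 <= M' s]. *)
Lemma dq_large_l2 n (q r M' : R) (s m : nat) (theta theta0 : Rvec R n) (U : {set 'I_n}) :
  0 < q -> q <= 2 -> 0 < r -> (0 < s)%N ->
  (forall i, i \notin U -> tnth theta i = tnth theta0 i) -> (#|U| <= m * s)%N ->
  (m%:R + M') * r `^ q * s%:R `^ (1 - q / 2) < dq q theta theta0 ->
  M' * r ^+ 2 < \sum_i (tnth theta i - tnth theta0 i) ^+ 2.
Proof.
move=> q0 q2 r0 s0 offU Ums; apply: contraTT; rewrite -!leNgt => u2.
have sR : 0 < s%:R :> R by rewrite ltr0n.
pose t := r / Num.sqrt s%:R.
have t0 : 0 < t by rewrite divr_gt0// sqrtr_gt0.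
have t2 : t ^+ 2 = r ^+ 2 / s%:R by rewrite /t expr_div_n sqr_sqrtr// ltW.
rewrite -mulrA powR_rate// -/t /dq (bigID (mem U))/= [X in _ + X]big1 ?addr0; last first.
  by move=> i iU; rewrite offU// subrr normr0 powR0// gt_eqF.
apply: (@le_trans _ _ (\sum_(i in U) t `^ q * (1 + (tnth theta i - tnth theta0 i) ^+ 2 / t ^+ 2))).
  apply: ler_sum => i _;
  have := powR_le_quadratic q0 q2 t0 (normr_ge0 (tnth theta i - tnth theta0 i)).
  by rewrite real_normK ?num_real.
rewrite -big_distrr/= mulrA [leRHS]mulrC ler_wpM2l ?powR_ge0// big_split/= sumr_const.
rewrite mulrDl lerD//; first by rewrite -natrM ler_nat.
rewrite -big_distrl/= t2 invf_div mulrA ler_pdivrMr ?exprn_gt0//.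
rewrite mulrAC ler_wpM2r ?ler0n//; apply: le_trans u2.
by rewrite [leRHS](bigID (mem U))/= lerDl sumr_ge0// => i _; exact: sqr_ge0.
Qed.

End distance.

(** * Small models: likelihood and evidence bounds *)

Section near_models.
Context (R : realType) (n : nat) (pi : dim_prior R n) (g : density R).
Variables (h : R -> R) (L : R).
Hypothesis g_exp : forall x, g x = expR (h x).
Hypothesis h_lip : forall x y, `|h x - h y| <= L * (1 + `|x - y|).
Implicit Types (x theta : Rvec R n) (S U : {set 'I_n}).

Let w := model_weight pi.
Let g_gt0 := slab_density_gt0 g_exp.

(* A smooth majorant of [r^-2 * \sum_i (eps_i^2 - tau)_+], by [y <= 4 * exp (y / 4)]. *)
Definition noise_excess (r tau : R) theta0 x : R :=
  4 / r ^+ 2 * \sum_i expR (((tnth x i - tnth theta0 i) ^+ 2 - tau) / 4).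

Lemma noise_excess_ge0 r tau theta0 x : 0 <= noise_excess r tau theta0 x.
Proof.
by rewrite mulr_ge0 ?divr_ge0 ?sqr_ge0// sumr_ge0// => i _; exact: expR_ge0.
Qed.

Lemma noise_le (r tau : R) theta0 x U : 0 < r -> noise_excess r tau theta0 x <= 1 ->
  \sum_(i in U) (tnth x i - tnth theta0 i) ^+ 2 <= #|U|%:R * tau + r ^+ 2.
Proof.
move=> r0; rewrite /noise_excess mulrAC ler_pdivrMr ?exprn_gt0// mul1r => W1.
apply: (@le_trans _ _ (\sum_(i in U) (tau + 4 * expR (((tnth x i - tnth theta0 i) ^+ 2 - tau) / 4)))).
  apply: ler_sum => i _; set e := _ ^+ 2.
  by have := expR_ge1Dx ((e - tau) / 4); lra.
rewrite big_split/= sumr_const mulr_natl lerD2l -big_distrr/=.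
apply: le_trans W1; rewrite ler_wpM2l// [leRHS](bigID (mem U))/= lerDl.
by apply: sumr_ge0 => i _; exact: expR_ge0.
Qed.

Lemma normal_densityE theta x :
  normal_density theta x =
  normal_peak 1 ^+ n * expR (- (\sum_i (tnth x i - tnth theta i) ^+ 2) / 2).
Proof.
rewrite /normal_density; under eq_bigr do rewrite normal_pdf1E.
rewrite big_split/= prodr_const card_ord -expR_sum; congr (_ * expR _).
by rewrite mulNr big_distrl/= -sumrN; apply: eq_bigr => i _; rewrite mulNr.
Qed.

(** Once the cross term is absorbed, [- 3 / 8 * ||u||^2] remains in the exponent: one eighth yields
    [c / 8], one quarter is kept as a product to be integrated under the slab. *)
Lemma normal_density_near theta theta0 x U (b c : R) :
  (forall i, i \notin U -> tnth theta i = tnth theta0 i) ->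
  \sum_(i in U) (tnth x i - tnth theta0 i) ^+ 2 <= b ->
  c <= \sum_i (tnth theta i - tnth theta0 i) ^+ 2 ->
  normal_density theta x <= normal_density theta0 x * expR (2 * b - c / 8) *
     \prod_i expR (- (tnth theta i - tnth theta0 i) ^+ 2 / 4).
Proof.
move=> offU eb cu; rewrite !normal_densityE -expR_sum -!mulrA -!expRD.
rewrite ler_wpM2l ?exprn_ge0 ?normal_peak_ge0// ler_expR.
pose e i := tnth x i - tnth theta0 i; pose u i := tnth theta i - tnth theta0 i.
(* AM-GM: [e u <= 2 e^2 + u^2 / 8] *)
have H : - (\sum_i (tnth x i - tnth theta i) ^+ 2) / 2 + (\sum_i e i ^+ 2) / 2 <=
    2 * (\sum_(i in U) e i ^+ 2) - 3 / 8 * \sum_i u i ^+ 2.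
  rewrite [X in 2 * X]big_mkcond/= !mulr_sumr mulNr !mulr_suml -!sumrN -!big_split/=.
  apply: ler_sum => i _.
  have -> : tnth x i - tnth theta i = e i - u i by rewrite /e /u; ring.
  case: ifPn => iU; last first.
    by rewrite (_ : u i = 0); [lra|rewrite /u offU// subrr].
  by have := sqr_ge0 (2 * e i - u i / 2); nra.
have -> : \sum_i - (tnth theta i - tnth theta0 i) ^+ 2 / 4 = - (\sum_i u i ^+ 2) / 4.
  by rewrite mulNr mulr_suml -sumrN; apply: eq_bigr => i _; rewrite mulNr.
move: H eb cu; rewrite -/e -/u.
rewrite (_ : \sum_i (tnth x i - tnth theta0 i) ^+ 2 = \sum_i e i ^+ 2)//.
rewrite (_ : \sum_i (tnth theta i - tnth theta0 i) ^+ 2 = \sum_i u i ^+ 2)//.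
rewrite (_ : \sum_(i in U) (tnth x i - tnth theta0 i) ^+ 2 = \sum_(i in U) e i ^+ 2)//.
lra.
Qed.

Variables (S1 : {set 'I_n}) (theta0 : Rvec R n).
Hypothesis off0 : forall i, i \notin S1 -> tnth theta0 i = 0.

Definition slab_ub : R := Num.max (slab_gauss_ub L) (zero_gauss_ub g L).

Lemma slab_ub_gt0 : 0 < slab_ub.
Proof. by rewrite lt_max slab_gauss_ub_gt0. Qed.

(** Only the model [S1] is kept; off [S1] its factors are those of [normal_density theta0]. *)
Lemma evidence_lb x : w #|S1| * (normal_density theta0 x *
    \prod_(i in S1) (marginal_lb L * g (tnth theta0 i))) <= evidence pi g x.
Proof.
rewrite /evidence (bigD1 S1)//=; apply: ler_wpDr.
  apply: sumr_ge0 => S _; rewrite mulr_ge0 ?model_weight_ge0// prodr_ge0// => i _.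
  by case: ifP => _; rewrite ?normal_pdf_ge0//; apply/ltW/slab_marginal_gt0.
rewrite ler_wpM2l ?model_weight_ge0// [X in _ * X]big_mkcond/= -big_split/=.
apply: ler_prod => i _; case: ifPn => iS.
  rewrite mulrC (slab_marginal_lb g_exp h_lip) andbT mulr_ge0 ?normal_pdf_ge0//.
  by rewrite mulr_ge0// ltW// marginal_lb_gt0.
by rewrite mulr1 off0// normal_pdf_ge0/=.
Qed.

(** Both alternatives cost at most [slab_ub * g (theta0_i)] on [S1] and at most 1 off [S1], so the
    bound does not depend on the model [S]. *)
Lemma prod_gauss_le S :
  \prod_i (if i \in S then slab_gauss g (tnth theta0 i)
           else expR (- (0 - tnth theta0 i) ^+ 2 / 4)) <=
  \prod_(i in S1) (slab_ub * g (tnth theta0 i)).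
Proof.
rewrite [leRHS]big_mkcond/=; apply: ler_prod => i _; apply/andP; split.
  by case: ifP => _; rewrite ?slab_gauss_ge0 ?expR_ge0.
case: (ifP (i \in S1)) => iS1; last first.
  by case: ifP => _; [exact: slab_gauss_le1|exact: gauss_le1].
have gi := ltW (g_gt0 (tnth theta0 i)).
case: ifP => _.
  apply: (le_trans (slab_gauss_le g_exp h_lip _)).
  by rewrite ler_wpM2r// le_max lexx.
apply: (le_trans (zero_gauss_le g_exp h_lip _)).
by rewrite ler_wpM2r// le_max lexx orbT.
Qed.

(** The pointwise bound is asked only of vectors vanishing off [S], which carry all the mass of
    [slab_law g S]. *)
Lemma integral_near S (B : set (Rvec R n)) (K : R) x : measurable B -> 0 <= K ->
  (forall theta, B theta -> (forall i, i \notin S -> tnth theta i = 0) ->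
    normal_density theta x <= K * \prod_i expR (- (tnth theta i - tnth theta0 i) ^+ 2 / 4)) ->
  (\int[slab_law g S]_(theta in B) (normal_density theta x)%:E <=
   (K * \prod_(i in S1) (slab_ub * g (tnth theta0 i)))%:E)%E.
Proof.
move=> mB K0 BK.
pose F theta := \prod_i expR (- (tnth theta i - tnth theta0 i) ^+ 2 / 4).
have mF : measurable_fun setT F.
  apply: (measurable_prod_tnth (f := fun i t => expR (- (t - tnth theta0 i) ^+ 2 / 4))).
  by move=> i; exact: measurable_gauss.
have F0 theta : 0 <= F theta by apply: prodr_ge0 => i _; exact: expR_ge0.
apply: (@le_trans _ _ (\int[slab_law g S]_(theta in B) (K%:E * (F theta)%:E)))%E.
  apply: ae_ge0_le_integral => //.
  - by move=> theta _; rewrite lee_fin ltW// normal_density_gt0.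
  - by apply/measurable_EFinP; apply: measurable_funTS; exact: measurable_normal_density.
  - by move=> theta _; rewrite mule_ge0// lee_fin.
  - apply: measurable_funTS; apply: emeasurable_funM => //; exact/measurable_EFinP.
  have := slab_law_ae_off_support g S; apply: filterS => theta offS Btheta.
  by rewrite -EFinM lee_fin BK.
apply: (@le_trans _ _ (\int[slab_law g S]_theta (K%:E * (F theta)%:E)))%E.
  apply: ge0_subset_integral => //.
  - by apply: emeasurable_funM => //; exact/measurable_EFinP.
  - by move=> theta _; rewrite mule_ge0// lee_fin.
rewrite ge0_integralZl//; last 2 first.
- exact/measurable_EFinP.
- by move=> theta _; rewrite lee_fin.
rewrite [leRHS]EFinM lee_wpmul2l ?lee_fin//.
rewrite (integral_slab_law_prod (f := fun i t => expR (- (t - tnth theta0 i) ^+ 2 / 4))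
  (c := fun i => slab_gauss g (tnth theta0 i))).
- by rewrite lee_fin; exact: prod_gauss_le.
- by move=> i; exact: measurable_gauss.
- by move=> i t; exact: expR_ge0.
- by move=> i _; exact: slab_gaussE.
Qed.

Variables (s j T : nat) (r tau A c : R) (B : set (Rvec R n)).
Hypotheses (S1s : #|S1| = s) (sj : (s + j <= n)%N) (sT : (s <= T)%N).
Hypotheses (r_gt0 : 0 < r) (tau_ge0 : 0 <= tau) (mB : measurable B).
Hypothesis tauA : (T + s)%:R * tau + r ^+ 2 <= A * r ^+ 2.
Hypothesis BC : forall theta S, B theta -> (#|S| <= T)%N ->
  (forall i, i \notin S -> tnth theta i = 0) ->
  c * r ^+ 2 < \sum_i (tnth theta i - tnth theta0 i) ^+ 2.

(** The terms stand for the models larger than [T], for the small models when the noise is moderate,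
    and for the event [noise_excess >= 1], where the trivial bound 1 on the posterior suffices. *)
Lemma posterior_pointwise x :
  posterior (prior pi (slab_law g)) x B <=
  dim_ratio pi g S1 s j T x +
  (expR ((2 * A - c / 8) * r ^+ 2) * (slab_ub / marginal_lb L) ^+ s / w s +
   noise_excess r tau theta0 x).
Proof.
have ev0 := evidence_gt0 pi g_exp h_lip x.
have lb0 := marginal_lb_gt0 L.
have ws0 : 0 < w s by apply: model_weight_gt0; lia.
have far := large_models_le pi g_exp h_lip S1s sj sT x.
have far0 : 0 <= (\sum_(S : {set 'I_n} | (T < #|S|)%N) w #|S| * model_density g x S) /
    evidence pi g x.
  rewrite divr_ge0 ?(ltW ev0)//; apply: sumr_ge0 => S _.
  rewrite mulr_ge0 ?model_weight_ge0// model_densityE mulr_ge0//.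
    exact/ltW/null_density_gt0.
  by apply: prodr_ge0 => i _; apply/ltW/(slab_ratio_gt0 g_exp h_lip).
have mid0 : 0 <= expR ((2 * A - c / 8) * r ^+ 2) * (slab_ub / marginal_lb L) ^+ s / w s.
  rewrite divr_ge0 ?(ltW ws0)// mulr_ge0 ?expR_ge0// exprn_ge0// divr_ge0 ?ltW//.
  exact: slab_ub_gt0.
have [W1|W1] := leP 1 (noise_excess r tau theta0 x).
  apply: (le_trans (posterior_le1 mB ev0)); lra.
set K := normal_density theta0 x * expR ((2 * A - c / 8) * r ^+ 2).
have K0 : 0 <= K by rewrite mulr_ge0 ?expR_ge0// ltW// normal_density_gt0.
pose PS := \prod_(i in S1) (slab_ub * g (tnth theta0 i)).
have PS0 : 0 <= PS.
  by apply: prodr_ge0 => i _; rewrite mulr_ge0 ?(ltW slab_ub_gt0)// ltW.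
pose b (S : {set 'I_n}) := if (T < #|S|)%N then model_density g x S else K * PS.
apply: (@le_trans _ _ ((\sum_(S : {set 'I_n}) w #|S| * b S) / evidence pi g x)).
  apply: posterior_le => // S; rewrite /b; case: ltnP => ST.
    exact: integral_slab_law_density_subset.
  apply: integral_near => // theta Bt offS.
  have offU i : i \notin S :|: S1 -> tnth theta i = tnth theta0 i.
    by rewrite inE negb_or => /andP[iS iS1]; rewrite offS// off0.
  rewrite /K (_ : (2 * A - c / 8) * r ^+ 2 = 2 * (A * r ^+ 2) - (c * r ^+ 2) / 8); last by ring.
  apply: (normal_density_near offU); last by apply: ltW; exact: BC offS.
  apply: (le_trans (noise_le _ r_gt0 (ltW W1))); apply: le_trans tauA.
  rewrite lerD2r ler_wpM2r// ler_nat (leq_trans (leq_card_setU _ _))//.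
  by rewrite S1s leq_add2r.
rewrite (bigID (fun S : {set 'I_n} => (T < #|S|)%N))/= mulrDl lerD//.
  apply: le_trans far; rewrite ler_wpM2r ?invr_ge0 ?(ltW ev0)//.
  by apply: ler_sum => S TS; rewrite /b TS.
apply: ler_wpDr; first exact: noise_excess_ge0.
rewrite ler_pdivrMr//.
apply: (@le_trans _ _ (K * PS)).
  (* The bound [K * PS] is the same for all small models, whose prior weights add up to at most
     1. *)
  rewrite -[leRHS]mul1r -[X in X * (K * PS)](model_weight_sum pi g) big_distrl/=.
  rewrite [leRHS](bigID (fun S : {set 'I_n} => (T < #|S|)%N))/=.
  apply: ler_wpDl.
    by apply: sumr_ge0 => S _; rewrite mulr_ge0 ?model_weight_ge0// mulr_ge0.
  by apply: ler_sum => S /negbTE TS; rewrite /b TS.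
(* Against the lower bound on the evidence, the likelihood of [theta0] and all [g (theta0_i)]
   cancel. *)
apply: (@le_trans _ _ (expR ((2 * A - c / 8) * r ^+ 2) * (slab_ub / marginal_lb L) ^+ s / w s *
  (w #|S1| * (normal_density theta0 x *
    \prod_(i in S1) (marginal_lb L * g (tnth theta0 i)))))); last first.
  by rewrite ler_wpM2l// evidence_lb.
rewrite S1s /PS !big_split/= !prodr_const S1s /K expr_div_n.
rewrite le_eqVlt; apply/orP; left; apply/eqP.
have lbs : marginal_lb L ^+ s != 0 by rewrite expf_neq0// gt_eqF.
have wsn : w s != 0 by rewrite gt_eqF.
move: lbs wsn; move: (w s) (marginal_lb L ^+ s) => y z y0 z0.
by field; rewrite y0 z0.
Qed.

End near_models.

(** * Nonasymptotic bound on the expected posterior mass *)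

Section risk_bound.
Context (R : realType).

Lemma measurable_dq_gt n (q a : R) (theta0 : Rvec R n) :
  measurable [set theta : Rvec R n | a < dq q theta theta0].
Proof.
have mdq : measurable_fun setT (fun theta : Rvec R n => dq q theta theta0).
  apply: (@measurable_sum _ _ _ _ _ _
    (fun i (theta : Rvec R n) => `|tnth theta i - tnth theta0 i| `^ q)) => i.
  apply: (measurableT_comp (measurable_powR _)); apply: measurableT_comp => //.
  by apply: measurable_funB => //; exact: measurable_tnth.
rewrite (_ : [set _ | _] =
    setT `&` (fun theta : Rvec R n => dq q theta theta0) @^-1` `]a, +oo[%classic).
  by apply: mdq => //; exact: measurable_itv.
by rewrite setTI; apply/seteqP; split=> theta /=; rewrite in_itv/= andbT.
Qed.

(** This is [sqrt 2], the mean of [exp (Z^2 / 4)] for a standard normal [Z], written as a quotient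
    of normalising constants. *)
Definition gauss_const : R := normal_peak 1 / normal_peak (Num.sqrt 2).

Lemma gauss_const_ge0 : 0 <= gauss_const.
Proof. by rewrite divr_ge0 ?normal_peak_ge0. Qed.

Lemma measurable_excess (a tau : R) :
  measurable_fun [set: R] (fun x => expR (((x - a) ^+ 2 - tau) / 4)).
Proof.
apply: measurableT_comp => //; apply: measurable_funM => //.
apply: measurable_funB => //; apply: measurable_funX; exact: measurable_funB.
Qed.

Lemma integral_normal_excess (a tau : R) :
  (\int[normal_prob a 1]_x (expR (((x - a) ^+ 2 - tau) / 4))%:E =
   (gauss_const * expR (- tau / 4))%:E)%E.
Proof.
have s2 : Num.sqrt 2 != 0 :> R by rewrite sqrtr_eq0 -ltNge.
rewrite integral_normal_prob; last 2 first.
- exact: measurable_excess.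
- by move=> x; exact: expR_ge0.
(* Multiplying by [exp ((x - a)^2 / 4)] turns the normal density of variance 1 into an unnormalised
   one of variance 2. *)
transitivity (\int[lebesgue_measure]_x
   ((gauss_const * expR (- tau / 4))%:E * (normal_pdf a (Num.sqrt 2) x)%:E))%E.
  apply: eq_integral => x _; rewrite -EFinM; congr EFin.
  rewrite normal_pdf1E normal_pdfE// /normal_fun sqr_sqrtr// /gauss_const.
  rewrite mulrCA -expRD.
  rewrite [RHS](_ : _ = normal_peak 1 * (expR (- tau / 4) *
    expR (- (x - a) ^+ 2 / (2 *+ 2)))); last first.
    by field; rewrite gt_eqF// normal_peak_gt0.
  rewrite -expRD; congr (_ * expR _); rewrite (_ : 2 *+ 2 = 4); last by ring.
  by field.
rewrite ge0_integralZl//.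
- by rewrite integral_normal_pdf mule1.
- by apply/measurable_EFinP; exact: measurable_normal_pdf.
- by move=> x _; rewrite lee_fin normal_pdf_ge0.
- by rewrite lee_fin mulr_ge0 ?gauss_const_ge0 ?expR_ge0.
Qed.

Lemma measurable_noise_excess n (r tau : R) (theta0 : Rvec R n) :
  measurable_fun setT (noise_excess r tau theta0).
Proof.
apply: measurable_funM => //.
apply: (@measurable_sum _ _ _ _ _ _ (fun i (x : Rvec R n) =>
  expR (((tnth x i - tnth theta0 i) ^+ 2 - tau) / 4))) => i.
apply: (measurableT_comp (measurable_excess (tnth theta0 i) tau)).
exact: measurable_tnth.
Qed.

Lemma integral_noise_excess n (r tau : R) (theta0 : Rvec R n) :
  (\int[normal_law theta0]_x (noise_excess r tau theta0 x)%:E =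
   (4 / r ^+ 2 * (n%:R * (gauss_const * expR (- tau / 4))))%:E)%E.
Proof.
have mt i : measurable_fun setT (fun x : Rvec R n =>
    expR (((tnth x i - tnth theta0 i) ^+ 2 - tau) / 4)).
  apply: (measurableT_comp (measurable_excess (tnth theta0 i) tau)).
  exact: measurable_tnth.
under eq_integral do rewrite EFinM -sumEFin.
rewrite ge0_integralZl//; last 3 first.
- apply: emeasurable_sum => i; apply/measurable_EFinP; exact: mt.
- by move=> x _; apply: sume_ge0 => i _; rewrite lee_fin expR_ge0.
- by rewrite lee_fin divr_ge0// sqr_ge0.
rewrite ge0_integral_sum//; last by move=> i; apply/measurable_EFinP; exact: mt.
rewrite [RHS]EFinM; congr (_ * _)%E.
under eq_bigr => i _.
  rewrite (integral_product_law_tnth (f := fun y => expR (((y - tnth theta0 i) ^+ 2 - tau) / 4))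
    (c := gauss_const * expR (- tau / 4))); last 3 first.
  - exact: measurable_excess.
  - by move=> y; exact: expR_ge0.
  - exact: integral_normal_excess.
  over.
by rewrite sumEFin sumr_const card_ord mulr_natl.
Qed.

(** One term of the binomial expansion gives ['C(n, s) * (s / n)^s <= (1 + s / n)^n <= exp s]. *)
Lemma binomial_le_exp (n s : nat) : (0 < s)%N -> (s <= n)%N ->
  'C(n, s)%:R <= expR (s%:R + s%:R * ln (n%:R / s%:R)) :> R.
Proof.
move=> s0 sn; have n0 : (0 < n)%N by lia.
have sR : 0 < s%:R :> R by rewrite ltr0n.
have nR : 0 < n%:R :> R by rewrite ltr0n.
pose y : R := s%:R / n%:R; have y0 : 0 < y by rewrite divr_gt0.
have H : 'C(n, s)%:R * y ^+ s <= expR s%:R.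
  apply: (@le_trans _ _ ((1 + y) ^+ n)).
    rewrite addrC exprDn_comm; last exact: commr1.
    have ns : (n - s < n.+1)%N by lia.
    rewrite (bigD1 (Ordinal ns))//= subKn// bin_sub// expr1n mulr1 mulr_natl lerDl.
    by apply: sumr_ge0 => i _; rewrite mulrn_wge0// mulr_ge0 ?exprn_ge0// ltW.
  rewrite (_ : s%:R = n%:R * y); last by rewrite /y mulrC divfK// gt_eqF.
  rewrite expRM_natl; apply: lerXn2r; rewrite ?nnegrE ?expR_ge0 ?expR_ge1Dx//.
  by rewrite addr_ge0// ltW.
rewrite expRD expRM_natl lnK ?posrE ?divr_gt0//.
have -> : (n%:R / s%:R : R) = y^-1 by rewrite /y invf_div.
by rewrite exprVn ler_pdivlMr ?exprn_gt0.
Qed.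

Lemma superset_of_card n (S : {set 'I_n}) (k : nat) : (#|S| <= k)%N -> (k <= n)%N ->
  exists S' : {set 'I_n}, S \subset S' /\ #|S'| = k.
Proof.
elim: k => [|k IH]; first by rewrite leqn0 => /eqP S0 _; exists S.
rewrite leq_eqVlt => /predU1P[Sk _|Sk kn]; first by exists S.
have [S' [SS' S'k]] := IH Sk (ltnW kn).
have [i iS'] : exists i, i \notin S'.
  apply/existsP; rewrite -negb_forall; apply/negP => /forallP H.
  by move: kn; rewrite -S'k -[X in (_ < X)%N]card_ord (eq_card H) ltnn.
exists (i |: S'); split; last by rewrite cardsU1 iS' S'k.
by rewrite (fintype.subset_trans SS')// finset.subsetUr.
Qed.

Variables (g : density R) (h : R -> R) (L : R).
Hypothesis g_exp : forall x, g x = expR (h x).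
Hypothesis h_lip : forall x y, `|h x - h y| <= L * (1 + `|x - y|).

Variables (D v : R) (K : nat).
Hypotheses (D_ge0 : 0 <= D) (v_ge0 : 0 <= v) (v_lt1 : v < 1) (K_gt0 : (0 < K)%N).
Hypothesis Dv : D * (1 + K%:R^-1) <= v ^+ 2.

(* Models of size above [(K + 2) s] are large; the others meet [S1] in a union of
   at most [(K + 3) s] coordinates, over which the noise has squared norm at most
   [rate_A * r^2]. *)
Definition rate_A : R := 4 * K.+3%:R + 1.
Definition rate_kappa : R := `|ln (slab_ub g L / marginal_lb L)|.
(** Makes [2 * rate_A - rate_c / 8 = - (4 + rate_kappa)]. With [s <= r^2], the total exponent [- (4
    + rate_kappa) r^2 + rate_kappa s + s + 2 r^2] is then at most [- s]. *)
Definition rate_c : R := 8 * (2 * rate_A + 4 + rate_kappa).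

(** The three terms bound, in this order, the large models, the small models and the mean of
    [noise_excess]. *)
Lemma posterior_risk_le n (pi : dim_prior R n) (s : nat) (q r M : R) (theta0 : Rvec R n) :
  (0 < s)%N -> (K.+1 * s <= n)%N ->
  (forall k, (K * s < k <= n)%N -> pi k <= D * pi k.-1) ->
  1 <= ln (n%:R / s%:R) :> R ->
  0 < q -> q <= 2 -> 0 < r ->
  s%:R * ln (n%:R / s%:R) <= r ^+ 2 -> ln (1 / pi s) <= r ^+ 2 ->
  K.+3%:R + rate_c <= M -> ell0 s theta0 ->
  (\int[normal_law theta0]_x (posterior (prior pi (slab_law g)) x
     [set theta | M * r `^ q * s%:R `^ (1 - q / 2) < dq q theta theta0])%:E <=
   (v ^+ s / (1 - v) / (1 - v ^+ 2) + expR (- s%:R) +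
    4 * gauss_const / ln (n%:R / s%:R))%:E)%E.
Proof.
move=> s0 Ksn pi_decr ln1 q0 q2 r0 rs rpi MM supp0.
have sn : (s <= n)%N by apply: leq_trans Ksn; rewrite leq_pmull.
have sR : 0 < s%:R :> R by rewrite ltr0n.
have nR : 0 < n%:R :> R by rewrite ltr0n (leq_trans s0).
have r2 : 0 < r ^+ 2 by rewrite exprn_gt0.
have sr : s%:R <= r ^+ 2 by apply: le_trans rs; rewrite ler_peMr// ltW.
have [S1 [S01 S1s]] := superset_of_card supp0 sn.
have off0 i : i \notin S1 -> tnth theta0 i = 0.
  apply: contraNeq => t0; move/fintype.subsetP: S01; apply.
  by rewrite inE.
(* With this [tau], [n * exp (- tau / 4) = s], so the mean noise excess is of order
   [s / r^2 <= 1 / ln (n / s)]; [T] equals [s + s + j]. *)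
pose j := (K * s)%N; pose T := (K.+2 * s)%N; pose tau : R := 4 * ln (n%:R / s%:R).
have sj : (s + j <= n)%N by move: Ksn; rewrite mulSn.
have ssjT : (s + s + j <= T)%N by rewrite /T !mulSn addnA.
have tau0 : 0 <= tau by rewrite /tau; lra.
pose B := [set theta : Rvec R n | M * r `^ q * s%:R `^ (1 - q / 2) < dq q theta theta0].
have mB : measurable B by exact: measurable_dq_gt.
have tauA : (T + s)%:R * tau + r ^+ 2 <= rate_A * r ^+ 2.
  rewrite /rate_A mulrDl mul1r lerD2r /T -mulSnr natrM /tau.
  rewrite (_ : _ * _ = 4 * K.+3%:R * (s%:R * ln (n%:R / s%:R))); last by ring.
  by rewrite ler_wpM2l.
have BC theta (S : {set 'I_n}) : B theta -> (#|S| <= T)%N ->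
    (forall i, i \notin S -> tnth theta i = 0) ->
    rate_c * r ^+ 2 < \sum_i (tnth theta i - tnth theta0 i) ^+ 2.
  move=> Bt ST offS.
  apply: (dq_large_l2 (U := S :|: S1) (m := K.+3) q0 q2 r0 s0).
  - by move=> i; rewrite inE negb_or => /andP[iS iS1]; rewrite offS// off0.
  - rewrite (leq_trans (leq_card_setU _ _))// S1s mulSnr; exact: leq_add.
  - apply: le_lt_trans Bt; rewrite ler_wpM2r ?powR_ge0// ler_wpM2r ?powR_ge0//.
have sT : (s <= T)%N by rewrite leq_pmull.
have pw := posterior_pointwise pi g_exp h_lip off0 S1s sj sT r0 tau0 mB tauA BC.
have w0 : 0 < model_weight pi s by exact: model_weight_gt0.
have ub0 := slab_ub_gt0 g L.
pose c2 := expR ((2 * rate_A - rate_c / 8) * r ^+ 2) *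
  (slab_ub g L / marginal_lb L) ^+ s / model_weight pi s.
have c20 : 0 <= c2.
  rewrite divr_ge0 ?(ltW w0)// mulr_ge0 ?expR_ge0// exprn_ge0// divr_ge0 ?(ltW ub0)//.
  exact/ltW/marginal_lb_gt0.
have c2s : c2 <= expR (- s%:R).
  have w1 : (model_weight pi s)^-1 <= expR (s%:R + 2 * r ^+ 2).
    rewrite /model_weight invf_div.
    have pis : 0 < pi s by exact: dim_weight_gt0.
    have -> : (pi s)^-1 = expR (ln (1 / pi s)) by rewrite lnK ?div1r// posrE invr_gt0.
    apply: (@le_trans _ _ (expR (s%:R + s%:R * ln (n%:R / s%:R)) * expR (r ^+ 2))).
      by apply: ler_pM; rewrite ?ler0n ?expR_ge0 ?binomial_le_exp ?ler_expR.
    by rewrite -expRD ler_expR; lra.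
  have ublb : (slab_ub g L / marginal_lb L) ^+ s <= expR (s%:R * rate_kappa).
    rewrite expRM_natl; apply: lerXn2r; rewrite ?nnegrE ?expR_ge0//.
      by rewrite divr_ge0 ?(ltW ub0)// ltW// marginal_lb_gt0.
    rewrite -[leLHS]lnK ?ler_expR ?ler_norm// posrE divr_gt0//.
    exact: marginal_lb_gt0.
  have k0 : 0 <= rate_kappa by exact: normr_ge0.
  apply: (@le_trans _ _ (expR ((2 * rate_A - rate_c / 8) * r ^+ 2) *
      expR (s%:R * rate_kappa) * expR (s%:R + 2 * r ^+ 2))).
    apply: ler_pM => //.
    - rewrite mulr_ge0 ?expR_ge0// exprn_ge0// divr_ge0 ?(ltW ub0)//.
      exact/ltW/marginal_lb_gt0.
    - by rewrite invr_ge0 ltW.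
    - by rewrite ler_wpM2l ?expR_ge0.
  rewrite -!expRD ler_expR /rate_c.
  have := ler_wpM2r k0 sr; lra.
apply: (@le_trans _ _ (\int[normal_law theta0]_x
   ((dim_ratio pi g S1 s j T x)%:E + (c2%:E + (noise_excess r tau theta0 x)%:E)))%E).
  apply: ge0_le_integral_nomeas => x; first by rewrite lee_fin posterior_ge0.
  by rewrite -!EFinD lee_fin; exact: pw.
have dr0 x : 0 <= dim_ratio pi g S1 s j T x.
  apply: sumr_ge0 => a _; apply: sumr_ge0 => k _.
  apply: mulr_ge0; last by rewrite divr_ge0// (off_poly_ge0 g_exp h_lip).
  rewrite divr_ge0//; apply/ltW/model_weight_gt0; first by rewrite -ltnS ltn_ord.
  by apply: leq_trans sj; rewrite leq_add2r -ltnS ltn_ord.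
have mdr := measurable_dim_ratio pi g_exp h_lip S1 s j T.
have mne := measurable_noise_excess r tau theta0.
have ne0 x := noise_excess_ge0 r tau theta0 x.
rewrite ge0_integralD//; last 4 first.
- by move=> x _; rewrite lee_fin.
- exact/measurable_EFinP.
- by move=> x _; rewrite adde_ge0// lee_fin.
- by apply: emeasurable_funD => //; exact/measurable_EFinP.
rewrite ge0_integralD//; last 2 first.
- by move=> x _; rewrite lee_fin.
- exact/measurable_EFinP.
rewrite integral_cst// [X in (_ * X)%E]probability_setT mule1.
rewrite integral_noise_excess -[X in (_ <= X%:E)%E]addrA [leRHS]EFinD; apply: leeD; last first.
  rewrite [leRHS]EFinD; apply: leeD; first by rewrite lee_fin.
  have -> : expR (- tau / 4) = s%:R / n%:R.
    rewrite (_ : - tau / 4 = - ln (n%:R / s%:R)); last by rewrite /tau; field.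
    by rewrite expRN lnK ?posrE ?divr_gt0// invf_div.
  rewrite lee_fin [leLHS](_ : _ = 4 * gauss_const * (s%:R / r ^+ 2)); last first.
    by field; rewrite !gt_eqF.
  apply: ler_wpM2l; first by apply: mulr_ge0 => //; exact: gauss_const_ge0.
  rewrite ler_pdivrMr// mulrC ler_pdivlMr//; exact: lt_le_trans ln1.
have sjT : (s + j <= T)%N by apply: leq_trans ssjT; rewrite -addnA leq_addl.
have j0 : (0 < j)%N by rewrite muln_gt0 K_gt0.
(* The geometric rate is [v ^+ 2] so that one factor [v ^+ s] can absorb the count [s + 1] while the
   other still decays. *)
have D'1 : v ^+ 2 < 1 by rewrite expr_lt1.
have DD' : D * (1 + s%:R / j%:R) <= v ^+ 2.
  by rewrite /j natrM invfM mulrCA divff ?mulr1// gt_eqF.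
apply: (le_trans (integral_dim_ratio pi g_exp h_lip S1s sj sjT off0)).
rewrite lee_fin.
apply: (le_trans (sum_dim_ratio_le S1s sj sjT D_ge0 (sqr_ge0 v) D'1 j0 pi_decr DD' ssjT)).
rewrite mulrA; apply: ler_wpM2r; first by rewrite invr_ge0 subr_ge0 ltW.
(* [(s + 1) v^s <= 1 + v + ... + v^s <= 1 / (1 - v)] *)
have vs : s.+1%:R * v ^+ s <= (1 - v)^-1.
  apply: (@le_trans _ _ (\sum_(i < s.+1) v ^+ i)).
    rewrite mulr_natl -[X in _ *+ X]card_ord -sumr_const; apply: ler_sum => i _.
    by apply: ler_wiXn2l; rewrite ?(ltW v_lt1)// -ltnS.
  rewrite -[leRHS]mul1r ler_pdivlMr ?subr_gt0//.
  have := subrX1 v s.+1; have := exprn_ge0 s.+1 v_ge0.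
  by move: (\sum_(_ < _) _) (v ^+ s.+1) => a b; lra.
rewrite -exprM mul2n -addnn exprD mulrA [leRHS]mulrC.
by apply: ler_wpM2r; rewrite ?exprn_ge0.
Qed.

End risk_bound.

(** * Limits along the sequence and nonemptiness of the parameter set *)

Section limits.
Context (R : realType).

Lemma near_ratio_le (p : nat -> nat) (e : R) : 0 < e ->
  (p n)%:R / n%:R @[n --> \oo] --> (0 : R) ->
  \forall n \near \oo, (p n)%:R / n%:R <= e.
Proof.
move=> e0 /cvgr0Pnorm_le/(_ _ e0); apply: filterS => n.
by rewrite ger0_norm// divr_ge0.
Qed.

Lemma cvg_inv_ln_ratio (p : nat -> nat) :
  (forall n, (0 < n)%N -> (1 <= p n <= n)%N) ->
  (p n)%:R / n%:R @[n --> \oo] --> (0 : R) ->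
  (ln (n%:R / (p n)%:R))^-1 @[n --> \oo] --> (0 : R).
Proof.
move=> p_bounds ps; apply/cvgr0Pnorm_le => e e0.
near=> n.
have n0 : (0 < n)%N by near: n; exact: nbhs_infty_gt.
have /andP[p1 pn] := p_bounds n n0.
have pR : 0 < (p n)%:R :> R by rewrite ltr0n.
have nR : 0 < n%:R :> R by rewrite ltr0n.
have H : (p n)%:R / n%:R <= expR (- e^-1) :> R.
  by near: n; apply: near_ratio_le => //; exact: expR_gt0.
have lnge : e^-1 <= ln (n%:R / (p n)%:R).
  rewrite -ler_expR lnK ?posrE ?divr_gt0//.
  by rewrite -[leRHS]invf_div -[leLHS]invrK -expRN lef_pV2 ?posrE ?expR_gt0 ?divr_gt0.
have e1 : 0 < e^-1 by rewrite invr_gt0.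
rewrite ger0_norm; last by rewrite invr_ge0 (le_trans (ltW e1)).
by rewrite -[leRHS]invrK lef_pV2// posrE (lt_le_trans e1).
Unshelve. all: by end_near. Qed.

(** Keeps the supremum over [ell0] from being that of the empty set, which is not nonnegative. *)
Lemma ell0_zero n k : @ell0 R n k [tuple of nseq n (0 : measurableTypeR R)].
Proof.
rewrite /ell0/= (_ : supp _ = finset.set0) ?cards0//.
by apply/setP => i; rewrite !inE (tnth_nth 0) /= nth_nseq ltn_ord eqxx.
Qed.

End limits.

(** * Choice of the constants and passage to the limit *)

Theorem theorem2p2 (R : realType)
    (p : nat -> nat) (p_bounds : forall n, (0 < n)%N -> (1 <= p n <= n)%N)
    (pi : forall n, dim_prior R n)
    (C D : R) (C_gt0 : 0 < C) (D_lt1 : D < 1)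
    (pi_decrease : forall n k, (0 < n)%N -> (k <= n)%N ->
      C * (p n)%:R < k%:R -> pi n k <= D * pi n k.-1)
    (g : density R) (h : R -> R) (g_exp : forall x, g x = expR (h x))
    (g_mean : (\int[lebesgue_measure]_x (x * g x)%:E)%E = 0%E)
    (g_moment2 : (\int[lebesgue_measure]_x (x ^+ 2 * g x)%:E < +oo)%E)
    (L : R) (h_lip : forall x y, `|h x - h y| <= L * (1 + `|x - y|))
    (q : R) (q_gt0 : 0 < q) (q_le2 : q <= 2)
    (r : nat -> R) (r_gt0 : forall n, (0 < n)%N -> 0 < r n)
    (r_rate : forall n, (0 < n)%N ->
      Num.max ((p n)%:R * ln (n%:R / (p n)%:R)) (ln (1 / pi n (p n)))
        <= r n ^+ 2)
    (p_infty : p n @[n --> \oo] --> \oo)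
    (p_sparse : (p n)%:R / n%:R @[n --> \oo] --> (0 : R)) :
  exists M0 : R, forall M : R, M0 <= M ->
    ereal_sup [set (\int[normal_law theta0]_x
        (posterior (prior (pi n) (slab_law g)) x
           [set theta | M * r n `^ q * (p n)%:R `^ (1 - q / 2)
                          < dq q theta theta0])%:E)%E
      | theta0 in @ell0 R n (p n)] @[n --> \oo] --> 0%E.
Proof.
(* Enlarging [D] preserves the exponential decrease and makes the rate positive. *)
pose D1 := Num.max D (1 / 2).
have D1_gt0 : 0 < D1 by rewrite lt_max divr_gt0 ?orbT.
have D1_lt1 : D1 < 1 by rewrite gt_max D_lt1; lra.
(* The first bound places the decrease beyond [K * p n]; the second keeps the factor [1 + 1 / K]
   from pushing the rate above [v ^ 2]. *)
have [K [KC KD]] : exists K : nat, C <= K%:R /\ 4 / (1 - D1) ^+ 2 <= K%:R.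
  have a0 : 0 <= C + 4 / (1 - D1) ^+ 2 by rewrite addr_ge0 ?divr_ge0 ?sqr_ge0// ltW.
  have := archi_boundP a0; set K := Num.bound _ => aK; exists K.
  have b0 : 0 <= 4 / (1 - D1) ^+ 2 by rewrite divr_ge0 ?sqr_ge0.
  by split; apply: (le_trans _ (ltW aK)); lra.
have K0 : (0 < K)%N by rewrite -(ltr_nat R) (lt_le_trans C_gt0).
(* [D1 < v ^ 2 < 1], with a margin of [(1 - D1)^2 / 4] *)
pose v := (1 + D1) / 2.
have v0 : 0 <= v by rewrite /v; lra.
have v1 : v < 1 by rewrite /v; lra.
have Dv : D1 * (1 + K%:R^-1) <= v ^+ 2.
  have KR : 0 < K%:R :> R by rewrite ltr0n.
  have d2 : 0 < (1 - D1) ^+ 2 by rewrite exprn_gt0// subr_gt0.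
  have Ki : K%:R^-1 <= (1 - D1) ^+ 2 / 4 :> R.
    by rewrite -[leRHS]invrK invf_div lef_pV2// posrE divr_gt0.
  have Ki0 : 0 <= K%:R^-1 :> R by rewrite invr_ge0 ltW.
  rewrite (_ : v ^+ 2 = D1 + (1 - D1) ^+ 2 / 4); last by rewrite /v; field.
  rewrite mulrDr mulr1 lerD2l; apply: le_trans Ki.
  by rewrite ler_piMl// ltW.
exists (K.+3%:R + rate_c g L K) => M MM.
pose b n := v ^+ p n / (1 - v) / (1 - v ^+ 2) + expR (- (p n)%:R) +
  4 * gauss_const R / ln (n%:R / (p n)%:R).
have cvgp (y : R) : 0 <= y -> y < 1 -> y ^+ p n @[n --> \oo] --> (0 : R).
  move=> y0 y1; apply: (cvg_comp p (GRing.exp y) p_infty).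
  by apply: cvg_expr; rewrite ger0_norm.
have cvgb : b n @[n --> \oo] --> (0 : R).
  rewrite /b (_ : 0 = 0 / (1 - v) / (1 - v ^+ 2) + 0 + 4 * gauss_const R * 0); last first.
    by rewrite !mul0r mulr0 !addr0.
  apply: cvgD; first apply: cvgD.
  - by apply: cvgMl; apply: cvgMl; exact: cvgp.
  (* The term is the [p n]-th power of [exp (- 1) < 1], so it is geometric as well. *)
  - under eq_cvg do rewrite -[_%:R]mulr1 -mulrN expRM_natl.
    apply: cvgp; first exact: expR_ge0.
    by rewrite expR_lt1; lra.
  - by apply: cvgMr; exact: cvg_inv_ln_ratio.
apply: (@squeeze_cvge _ _ _ _ (cst 0%E) _ (fun n => (b n)%:E)); last 2 first.
- exact: cvg_cst.
- by apply: cvg_EFin => //; exact: nearW.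
near=> n.
have n0 : (0 < n)%N by near: n; exact: nbhs_infty_gt.
have /andP[p1 pn] := p_bounds n n0.
have pR : 0 < (p n)%:R :> R by rewrite ltr0n.
have nR : 0 < n%:R :> R by rewrite ltr0n.
have Kpn : (K.+1 * p n <= n)%N.
  rewrite -(ler_nat R) natrM mulrC -ler_pdivlMr ?ltr0n// mulrC -ler_pdivrMr//.
  by near: n; apply: near_ratio_le => //; rewrite invr_gt0 ltr0n.
have ln1 : 1 <= ln (n%:R / (p n)%:R) :> R.
  rewrite -ler_expR lnK ?posrE ?divr_gt0//.
  rewrite -[leRHS]invf_div -[leLHS]invrK -expRN lef_pV2 ?posrE ?expR_gt0 ?divr_gt0//.
  by near: n; apply: near_ratio_le => //; exact: expR_gt0.
apply/andP; split.
  apply: le_trans (ereal_sup_ubound _); last first.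
    by exists [tuple of nseq n (0 : measurableTypeR R)]; first exact: ell0_zero.
  by apply: integral_ge0 => x _; rewrite lee_fin posterior_ge0.
apply: ge_ereal_sup => _ [theta0 theta0p <-].
have := r_rate n n0; rewrite ge_max => /andP[r1 r2].
apply: (posterior_risk_le g_exp h_lip (ltW D1_gt0) v0 v1 K0 Dv) => //.
- move=> k /andP[Kk kn].
  have k0 : (0 < k)%N by apply: leq_ltn_trans Kk.
  apply: (le_trans (pi_decrease n k n0 kn _)).
    apply: (@le_lt_trans _ _ (K * p n)%:R); last by rewrite ltr_nat.
    by rewrite natrM ler_wpM2r// ltW.
  apply: ler_wpM2r; last by rewrite le_max lexx.
  by apply/ltW/dim_weight_gt0; apply: leq_trans kn; exact: leq_pred.
- exact: r_gt0.
Unshelve. all: by end_near. Qed.
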